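(* Fix reals $\delta>0$ and $\epsilon>0$ with $C=\delta^2-16\ln(2)\epsilon>0$. Then there is a sequence $(\eta_d)_{d\ge1}$ with $\eta_d\to0$ as $d\to\infty$ such that for all sufficiently large $d$ the following holds. Let $r_1,\ldots,r_d$ be positive integers, let $S,T$ be nonempty sets of vertices of $G=K_{r_1}\,\square\,K_{r_2}\,\square\cdots\square\,K_{r_d}$ with $d_*(S,T)\ge\delta d$, and let $\rho\in(0,1)$ with $|1/2-\rho|<\epsilon$. Then $$|\widehat{m}_\rho(S,T)|>\sqrt{|S||T|}\;e^{Cd(1/2+\eta_d)}.$$
   Context: $K_r$ is the complete graph on $r$ vertices and $\square$ is the Cartesian product, so the distance $d(x,y)$ in $G$ is the number of coordinates in which $x$ and $y$ differ. For points $a,b$ and $0<\rho<1$, $$\widehat{m}_\rho(a,b)=\{u: d(a,u)=\lfloor\rho d(a,b)\rfloor,\ d(a,u)+d(u,b)=d(a,b)\}\cup\{u: d(a,u)=\lceil(1-\rho)d(a,b)\rceil,\ d(a,u)+d(u,b)=d(a,b)\},$$ and $\widehat{m}_\rho(S,T)=\bigcup_{s\in S,t\in T}\widehat{m}_\rho(s,t)$. Also $d_*(S,T)=\min\{d(s,t):s\in S,t\in T\}$. *)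

(* Defs.v *)
From mathcomp Require Import all_boot all_order all_algebra.
From mathcomp Require Import reals.

Set Implicit Arguments.
Unset Strict Implicit.
Unset Printing Implicit Defensive.

Import Order.TTheory GRing.Theory Num.Theory.

Local Open Scope ring_scope.

Definition walk (V : finType) (e : rel V) (n : nat) (x y : V) : bool :=
  [exists p : n.-tuple V, path e x p && (last x p == y)].

(* A shortest walk has fewer than #|V| edges; the value is #|V| when y is not
   reachable from x. *)
Definition gdist (V : finType) (e : rel V) (x y : V) : nat :=
  find (fun n => walk e n x y) (iota 0 #|V|).

(* Since gdist never exceeds #|V|, the neutral element #|V| does not affect
   the minimum when S and T are nonempty (see gdist_setP). *)
Definition gdist_set (V : finType) (e : rel V) (S T : {set V}) : nat :=
  \big[minn/#|V|]_(p in setX S T) gdist e p.1 p.2.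

Definition hatmid (R : realType) (V : finType) (e : rel V) (rho : R)
    (a b : V) : {set V} :=
  [set u | ((gdist e a u)%:Z == Num.floor (rho * (gdist e a b)%:R))
           && (gdist e a u + gdist e u b == gdist e a b)%N]
  :|:
  [set u | ((gdist e a u)%:Z == Num.ceil ((1 - rho) * (gdist e a b)%:R))
           && (gdist e a u + gdist e u b == gdist e a b)%N].

Definition hatmid_set (R : realType) (V : finType) (e : rel V) (rho : R)
    (S T : {set V}) : {set V} :=
  \bigcup_(s in S) \bigcup_(t in T) hatmid e rho s t.

Definition complete_graph (r : nat) : rel 'I_r := fun x y => x != y.

Definition cartprod (I : finType) (V : I -> finType)
    (e : forall i, rel (V i)) : rel {dffun forall i, V i} :=
  fun x y =>
    [exists i, e i (x i) (y i) && [forall j, (j != i) ==> (x j == y j)]].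

Definition hvertex (d : nat) (r : 'I_d -> nat) : finType :=
  {dffun forall i : 'I_d, 'I_(r i)}.

Definition hamming_graph (d : nat) (r : 'I_d -> nat) : rel (hvertex r) :=
  cartprod (fun i => @complete_graph (r i)).

Definition hamming (d : nat) (r : 'I_d -> nat) (x y : hvertex r) : nat :=
  #|[set i | x i != y i]|.

Section GraphDistance.
Variables (V : finType) (e : rel V).

Lemma walkP (n : nat) (x y : V) :
  reflect (exists p : seq V, [/\ size p = n, path e x p & last x p = y])
          (walk e n x y).
Proof.
apply: (iffP existsP) => [[p /andP[ep /eqP lp]]|[p [sp ep lp]]].
  by exists p; rewrite size_tuple.
have sp' : size p == n by apply/eqP.
by exists (Tuple sp') => /=; rewrite ep lp eqxx.
Qed.

Lemma gdist_minimal (x y : V) (m : nat) :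
  walk e m x y -> (forall n, walk e n x y -> (m <= n)%N) -> gdist e x y = m.
Proof.
move=> wm hm.
have mV : (m < #|V|)%N.
  case/walkP: wm => p [_ ep lp].
  case/shortenP: ep lp => p' ep' up' _ lp'.
  have wp' : walk e (size p') x y by apply/walkP; exists p'.
  apply: leq_ltn_trans (hm _ wp') _.
  have := max_card (mem (x :: p')); rewrite (card_uniqP up') /=.
  by [].
set s := iota 0 #|V|.
have hs : has (fun n => walk e n x y) s.
  by apply/hasP; exists m => //; rewrite mem_iota.
apply/eqP; rewrite eqn_leq; apply/andP; split.
  rewrite leqNgt; apply/negP => lt_m.
  by have := before_find 0%N lt_m; rewrite nth_iota // add0n wm.
apply: hm; have := nth_find 0%N hs.
by rewrite nth_iota ?add0n //; move: hs; rewrite has_find size_iota.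
Qed.

Lemma gdist_le_card (x y : V) : (gdist e x y <= #|V|)%N.
Proof.
by have := find_size (fun n => walk e n x y) (iota 0 #|V|); rewrite size_iota.
Qed.

Lemma gdist_set_le (S T : {set V}) (s t : V) :
  s \in S -> t \in T -> (gdist_set e S T <= gdist e s t)%N.
Proof.
move=> sS tT; have pST : (s, t) \in setX S T by rewrite inE /= sS tT.
rewrite /gdist_set; have := mem_index_enum (s, t).
elim: (index_enum _) => // p l IH; rewrite inE big_cons => /orP[/eqP <-|/IH le].
  by rewrite pST geq_minl.
by case: ifP => // _; apply: leq_trans (geq_minr _ _) le.
Qed.

Lemma gdist_setP (S T : {set V}) : S != set0 -> T != set0 ->
  exists s t, [/\ s \in S, t \in T & gdist_set e S T = gdist e s t].
Proof.
case/set0Pn => s sS /set0Pn[t tT].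
suff [E|[[s' t']]] : gdist_set e S T = #|V| \/
    exists2 p, p \in setX S T & gdist_set e S T = gdist e p.1 p.2.
- exists s, t; split=> //; apply/eqP; rewrite eqn_leq gdist_set_le //=.
  by rewrite E gdist_le_card.
- by rewrite inE /= => /andP[? ?] ?; exists s', t'.
rewrite /gdist_set; elim/big_rec: _ => [|p n pST IH]; first by left.
rewrite /minn; case: ifP => _; last exact: IH.
by right; exists p.
Qed.

End GraphDistance.

Section HammingDistance.
Variables (d : nat) (r : 'I_d -> nat).
Implicit Types x y z : hvertex r.

Lemma hamming_edge x y z :
  hamming_graph x y -> (hamming x z <= (hamming y z).+1)%N.
Proof.
case/existsP => i /andP[_ /forallP h].
rewrite /hamming; have sub : [set j | x j != z j] \subset i |: [set j | y j != z j].
  apply/subsetP => j; rewrite !inE; case: (boolP (j == i)) => //= ji.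
  have E : x j = y j by apply/eqP; move: (h j); rewrite ji.
  by rewrite E.
apply: leq_trans (subset_leq_card sub) _; rewrite cardsU1.
by case: (_ \notin _); rewrite ?add1n ?add0n.
Qed.

Lemma hammingxx x : hamming x x = 0%N.
Proof. by apply/eqP; rewrite cards_eq0; apply/eqP/setP => i; rewrite !inE eqxx. Qed.

Lemma gdist_hamming x y : gdist (@hamming_graph d r) x y = hamming x y.
Proof.
apply: gdist_minimal => [|n /walkP[p [<- ep <-]]]; last first.
  elim: p x ep {n y} => [|z p IH] x /=; first by rewrite hammingxx.
  case/andP => xz /IH le; apply: leq_trans (hamming_edge _ xz) _.
  by rewrite ltnS.
have [n hn] : exists n, hamming x y = n by exists (hamming x y).
rewrite hn; elim: n x hn => [|n IH] x hn.
  apply/walkP; exists [::]; split=> //=; apply/ffunP => i.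
  apply/eqP; apply: contraT => ni.
  move/eqP: hn; rewrite cards_eq0 => /eqP/setP/(_ i).
  by rewrite !inE ni.
have /card_gt0P[i] : (0 < hamming x y)%N by rewrite hn.
rewrite inE => xyi.
pose z : hvertex r := [ffun j => if j == i then y j else x j].
have zy : hamming z y = n.
  apply/eqP; rewrite -eqSS -hn /hamming (cardsD1 i [set j | x j != y j]).
  rewrite inE xyi add1n eqSS; apply/eqP; apply: eq_card => j.
  by rewrite !inE ffunE; case: (j == i); rewrite //= eqxx.
have /walkP[p [sp ep lp]] := IH _ zy.
apply/walkP; exists (z :: p); split=> //=; first by rewrite sp.
rewrite ep andbT; apply/existsP; exists i; rewrite /complete_graph ffunE eqxx xyi /=.
by apply/forallP => j; apply/implyP => /negbTE ji; rewrite ffunE ji.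
Qed.

End HammingDistance.

(* Main.v *)
(* For s, t and a set A of coordinates let u be s with the coordinates in A taken
   from t, and v the result of the opposite exchange.  If A meets the set where s
   and t differ in exactly floor(rho d(s,t)) points, then both u and v lie in the
   rho-midpoint set of s and t.

   Choose A uniformly among all sets of coordinates and (s,t) from the coupling of
   the uniform laws on S and T that is built coordinate by coordinate from optimal
   total variation couplings.  In one coordinate with marginals p, q at total
   variation distance tau, u and v both have law nu = (p + q)/2, and
   2 H(nu) - H(p) - H(q) >= tau^2; this is the displacement convexity of entropy
   that produces the exponent d(S,T)^2 / d.

   The exact size condition on A has only probability exp(-O(epsilon^2 d)) / poly(d),
   so entropies are replaced by an inequality of Prekopa-Leindler type that carries
   an arbitrary weight w(s,t,A): if w^n f(s) g(t) <= phi(u) psi(v), then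
   E[gamma^d(s,t) w]^n (sum f)(sum g) <= kappa^d (sum phi)(sum psi), where
   gamma = exp(2 mu / n) and kappa is about exp(mu^2) when n is large.  It follows
   from Hoelder's inequality for one coordinate and it tensorizes.  With mu close to
   delta and n close to delta / epsilon, all losses together stay below
   16 ln(2) epsilon d, so that eta = 0 works. *)

Require Import Defs.
From mathcomp Require Import all_boot all_order all_algebra.
From mathcomp Require Import all_classical all_reals all_analysis.
From mathcomp Require Import ring lra.

Import Order.TTheory GRing.Theory Num.Theory.
Import numFieldNormedType.Exports.

Local Open Scope ring_scope.

Set Implicit Arguments.
Unset Strict Implicit.

(** * Elementary inequalities *)

Lemma is_derive_nondecreasing (R : realType) (f df : R -> R) (a b : R) :
  a <= b -> (forall x, a <= x <= b -> is_derive x 1 f (df x)) ->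
  (forall x, a <= x <= b -> 0 <= df x) -> f a <= f b.
Proof.
move=> ab fdf df0.
have [||c] := @MVT_segment R f df a b ab.
- by move=> x /itvP xab; apply: fdf; rewrite !xab.
- apply: derivable_within_continuous => x; rewrite in_itv /= => /fdf h.
  exact: ex_derive.
rewrite in_itv /= => cab E; rewrite -subr_ge0 E mulr_ge0 ?subr_ge0 //.
exact: df0.
Qed.

(** The difference of the two sides vanishes at 0 and has derivative
    [2 * x ^+ 2 / ((1 + x) * (1 - x))]. This is the derivative estimate behind
    [entropy_gap_ge_sqr]. *)
Lemma artanh_ge (R : realType) (h : R) :
  0 <= h < 1 -> 2 * h <= ln (1 + h) - ln (1 - h).
Proof.
case/andP=> h0 h1.
pose f (x : R) := ln (1 + x) - ln (1 - x) - 2 * x.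
suff : f 0 <= f h by rewrite /f addr0 subr0 ln1; lra.
apply: (@is_derive_nondecreasing R f
  (fun x => (1 + x)^-1 - (1 - x)^-1 * (-1) - 2)) => // x /andP[x0 xh].
  have p1 : 0 < 1 + x by lra.
  have p2 : 0 < 1 - x by lra.
  rewrite /f.
  have d1 : is_derive x 1 (fun x : R => 1 + x) 1.
    by apply: is_derive_eq; ring.
  have d2 : is_derive x 1 (fun x : R => 1 - x) (-1).
    by apply: is_derive_eq; ring.
  have d3 := @is_derive1_comp R (@ln R) (fun x => 1 + x) x _ _ (is_derive1_ln p1) d1.
  have d4 := @is_derive1_comp R (@ln R) (fun x => 1 - x) x _ _ (is_derive1_ln p2) d2.
  have d5 : is_derive x 1 (fun x : R => 2 * x) 2.
    by apply: is_derive_eq; rewrite /GRing.scale /=; ring.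
  rewrite -[(1 + x)^-1]mulr1.
  exact: is_deriveB.
have p1 : 0 < 1 + x by lra.
have p2 : 0 < 1 - x by lra.
have -> : (1 + x)^-1 - (1 - x)^-1 * (-1) - 2 = 2 * x ^+ 2 / ((1 + x) * (1 - x)).
  by field; rewrite ?gt_eqF.
by rewrite divr_ge0 ?mulr_ge0 ?sqr_ge0 // ltW.
Qed.

(** Up to a factor [nu], the right side is the entropy gap of two masses [nu * (1 + h)] and
    [nu * (1 - h)] with mean [nu]. *)
Lemma entropy_gap_ge_sqr (R : realType) (h : R) : 0 <= h < 1 ->
  h ^+ 2 <= (1 + h) * ln (1 + h) + (1 - h) * ln (1 - h).
Proof.
case/andP=> h0 h1.
pose f (x : R) := (1 + x) * ln (1 + x) + (1 - x) * ln (1 - x) - x * x.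
suff : f 0 <= f h by rewrite /f addr0 subr0 ln1 expr2; lra.
apply: (@is_derive_nondecreasing R f
  (fun x => ln (1 + x) - ln (1 - x) - 2 * x)) => // x /andP[x0 xh].
  have p1 : 0 < 1 + x by lra.
  have p2 : 0 < 1 - x by lra.
  have d1 : is_derive x 1 (fun x : R => 1 + x) 1.
    by apply: is_derive_eq; ring.
  have d2 : is_derive x 1 (fun x : R => 1 - x) (-1).
    by apply: is_derive_eq; ring.
  have d3 := @is_derive1_comp R (@ln R) (fun x => 1 + x) x _ _ (is_derive1_ln p1) d1.
  have d4 := @is_derive1_comp R (@ln R) (fun x => 1 - x) x _ _ (is_derive1_ln p2) d2.
  have d5 := is_deriveB (is_deriveD (is_deriveM d1 d3) (is_deriveM d2 d4))
    (is_deriveM (is_derive_id x 1) (is_derive_id x 1)).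
  apply: is_derive_eq d5 _; rewrite /GRing.scale /=; field.
  by rewrite !gt_eqF.
by rewrite subr_ge0 artanh_ge // x0 (le_lt_trans xh).
Qed.

(** Squaring [expR y <= (1 - y)^-1] at [y = x / 2] leaves the sign of [1 - 6 * y + 4 * y ^+ 2]; the
    bound 1/3 on [x] makes [1 - 6 * y] nonnegative. *)
Lemma expR_le_quadratic (R : realType) (x : R) :
  x <= 1 / 3 -> expR x <= 1 + x + x ^+ 2.
Proof.
move=> x3; set y := x / 2.
have y0 : 0 < 1 - y by rewrite /y; lra.
have ey : expR y <= (1 - y)^-1.
  rewrite -[y]opprK expRN lef_pV2 ?posrE ?expR_gt0 ?opprK //.
  by have := expR_ge1Dx (- y).
have -> : x = y + y by rewrite /y; lra.
rewrite expRD; apply: (le_trans (ler_pM (expR_ge0 _) (expR_ge0 _) ey ey)).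
rewrite -invfM -[_^-1]mul1r ler_pdivrMr ?mulr_gt0 //.
rewrite -subr_ge0.
have -> : (1 + (y + y) + (y + y) ^+ 2) * ((1 - y) * (1 - y)) - 1
  = y ^+ 2 * (1 - 6 * y + 4 * y ^+ 2) by ring.
have y6 : 0 <= 1 - 6 * y by rewrite /y; lra.
apply: mulr_ge0; first exact: sqr_ge0.
by apply: addr_ge0 => //; apply: mulr_ge0 => //; exact: sqr_ge0.
Qed.

(** The bound [1 - x <= expR (- x)] at 13/160 is raised to the eighth power. The value 13/20 gives
    [16 * ln 2 >= 52/5], the budget of the final estimate. *)
Lemma ln2_ge (R : realType) : 13 / 20 <= ln 2 :> R.
Proof.
rewrite -ler_expR lnK ?posrE // -[X in expR X]opprK expRN.
have -> : - (13 / 20) = 8%:R * (- (13 / 160)) :> R by field.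
rewrite expRM_natl -[leRHS]invrK lef_pV2 ?posrE ?exprn_gt0 ?expR_gt0 ?invr_gt0 //.
have e0 : 0 <= 1 + (- (13 / 160)) :> R by lra.
apply: le_trans (lerXn2r 8 _ _ (expR_ge1Dx _)); rewrite ?nnegrE ?expR_ge0 //.
by rewrite !exprS expr0; lra.
Qed.

(* If x = 0, the junk value [nu / 0 = 0], [ln 0 = 0] is multiplied by 0. *)
Lemma jensen_shannon_ge (R : realType) (x y nu : R) :
  0 <= x -> 0 <= y -> nu = (x + y) / 2 ->
  x * ln (nu / x) + y * ln (nu / y) <= - ((x - y) ^+ 2 / (4 * nu)).
Proof.
wlog : x y / y <= x => [H x0 y0 nuE|yx x0 y0 nuE].
  have [yx|/ltW xy] := leP y x; first exact: H.
  have -> : (x - y) ^+ 2 = (y - x) ^+ 2 by ring.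
  by rewrite addrC; apply: H => //; rewrite nuE addrC.
(* For [y = 0] the ratio [h] below would be 1, outside [entropy_gap_ge_sqr]; there the claim reduces
   to [ln 2 >= 1/2]. *)
have [y_le0|y_gt0] := leP y 0.
  have yE : y = 0 by lra.
  rewrite nuE yE mul0r !addr0 subr0.
  have [x_le0|x_gt0] := leP x 0.
    have -> : x = 0 by lra.
    by rewrite mul0r expr2 !mul0r oppr0.
  have -> : x / 2 / x = 2^-1 by field; rewrite gt_eqF.
  have -> : x ^+ 2 / (4 * (x / 2)) = x / 2 by field; rewrite gt_eqF.
  rewrite lnV ?posrE // mulrN lerN2 ler_pM2l //.
  by have := ln2_ge R; lra.
have x_gt0 : 0 < x by lra.
have nu0 : 0 < nu by rewrite nuE; lra.
set h := (x - y) / (x + y).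
have h01 : 0 <= h < 1.
  by rewrite /h divr_ge0 ?ltr_pdivrMr /=; lra.
have xE : x = nu * (1 + h) by rewrite nuE /h; field; rewrite gt_eqF //; lra.
have yE : y = nu * (1 - h) by rewrite nuE /h; field; rewrite gt_eqF //; lra.
have [p1 p2] : 0 < 1 + h /\ 0 < 1 - h by move: h01; clearbody h; lra.
have xV : nu / x = (1 + h)^-1.
  by rewrite xE; field; rewrite !gt_eqF.
have yV : nu / y = (1 - h)^-1.
  by rewrite yE; field; rewrite !gt_eqF.
rewrite xV yV !lnV ?posrE //.
have -> : (x - y) ^+ 2 / (4 * nu) = nu * h ^+ 2.
  by rewrite xE yE; field; rewrite gt_eqF.
have := ler_wpM2l (ltW nu0) (entropy_gap_ge_sqr h01).
by rewrite xE yE; clear; clearbody h; lra.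
Qed.

Lemma bernoulli_ineq (R : realType) (t : R) (n : nat) : 1 <= t ->
  1 + n%:R * (t - 1) <= t ^+ n.
Proof.
move=> t1; elim: n => [|n IH]; first by rewrite mul0r addr0 expr0.
have tn : 1 <= t ^+ n by rewrite exprn_ege1.
by rewrite exprS -natr1; nra.
Qed.

(** The error is measured by [expR l - 1] because [l] will be unbounded on the diagonal of the
    coupling while [expR l - 1] times the mass there stays small. With [t = expR (l / N)], the error
    is at most [(t - 1) ^+ 2 / t], and Bernoulli's inequality, summed over the increments of
    [t ^+ m], compares this with [t ^+ N - 1]. *)
Lemma expR_div_le (R : realType) (N : nat) (l : R) : (0 < N)%N -> 0 <= l ->
  expR (l / N%:R) <= 1 + l / N%:R + 2 * (expR l - 1) / N%:R ^+ 2.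
Proof.
move=> N0 l0; have n0 : 0 < N%:R :> R by rewrite ltr0n.
set x := l / N%:R; set t := expR x.
have x0 : 0 <= x by rewrite divr_ge0 // ltW.
have t1 : 1 <= t by rewrite -expR0 ler_expR.
have -> : expR l = t ^+ N.
  by rewrite /t -expRM_natl /x; congr expR; field; rewrite gt_eqF.
have key m : m%:R ^+ 2 * (t - 1) ^+ 2 <= 2 * t * (t ^+ m - 1).
  elim: m => [|m IH]; first by rewrite expr0 subrr mulr0 expr2 !mul0r.
  have := bernoulli_ineq m.+1 t1.
  rewrite exprS -natr1 => B.
  have m0 : 0 <= m%:R :> R by rewrite ler0n.
  have := ler_wpM2l (_ : 0 <= 2 * (t - 1)) B.
  by move=> /(_ ltac:(lra)) B2; nra.
have xt : 1 - t^-1 <= x.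
  have := expR_ge1Dx (- x); rewrite expRN -/t; lra.
have ti : t * t^-1 = 1 by rewrite divff // gt_eqF //; lra.
have N2 : 0 < N%:R ^+ 2 :> R by rewrite exprn_gt0.
suff : (t - 1) ^+ 2 / t <= 2 * (t ^+ N - 1) / N%:R ^+ 2.
  have -> : (t - 1) ^+ 2 / t = t - 2 + t^-1 by field; rewrite gt_eqF //; lra.
  by lra.
rewrite ler_pdivrMr; last by lra.
rewrite mulrAC ler_pdivlMr //.
by have := key N; lra.
Qed.

(** Polya's proof: each factor [w] is at most [m * expR (w / m - 1)], where [m] is the weighted
    mean. *)
Lemma weighted_AGM (R : realType) (N : nat) (x y z : R) :
  0 <= x -> 0 <= y -> 0 <= z ->
  x * y * z ^+ N <= ((x + y + N%:R * z) / N.+2%:R) ^+ N.+2.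
Proof.
move=> x0 y0 z0; set m := _ / _.
have n0 : 0 < N.+2%:R :> R by rewrite ltr0n.
have Nz : 0 <= N%:R * z by rewrite mulr_ge0.
have m0 : 0 <= m by rewrite /m divr_ge0 ?addr_ge0 // ltW.
have mE : x + y + N%:R * z = m * N.+2%:R by rewrite /m divfK // gt_eqF.
have [mz|mn0] := eqVneq m 0.
  have -> : x = 0 by move: mE; rewrite mz mul0r; lra.
  by rewrite !mul0r exprn_ge0.
have mp : 0 < m by rewrite lt_neqAle eq_sym mn0.
(* The exponents w / m - 1 sum to 0 with multiplicity. *)
have le w : 0 <= w -> w <= m * expR (w / m - 1).
  move=> w0; rewrite mulrC -ler_pdivrMr //.
  by have := expR_ge1Dx (w / m - 1); lra.
apply: (@le_trans _ _ ((m * expR (x / m - 1)) * (m * expR (y / m - 1)) *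
                       (m * expR (z / m - 1)) ^+ N)).
  apply: ler_pM; rewrite ?mulr_ge0 ?exprn_ge0 //.
    by apply: ler_pM; rewrite ?le.
  by apply: lerXn2r; rewrite ?nnegrE ?le // mulr_ge0 ?expR_ge0.
rewrite exprMn -expRM_natl.
have -> : m * expR (x / m - 1) * (m * expR (y / m - 1)) *
   (m ^+ N * expR (N%:R * (z / m - 1))) =
   m ^+ N.+2 * expR ((x / m - 1) + (y / m - 1) + N%:R * (z / m - 1)).
  by rewrite !expRD !exprS; ring.
have -> : (x / m - 1) + (y / m - 1) + N%:R * (z / m - 1) =
  (x + y + N%:R * z) / m - N.+2%:R by rewrite -!natr1; field.
by rewrite mE [m * _ / m]mulrAC (divff mn0) mul1r subrr expR0 mulr1.
Qed.

(** * Optimal couplings in one coordinate *)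

(** The quotient lies between 1/2 and 1. This keeps the logarithmic weights bounded where one
    marginal exceeds the other, hence off the diagonal of the coupling. *)
Lemma ln_mean_ratio_bounds (R : realType) (x y : R) : 0 < x -> 0 <= y <= x ->
  -1 <= ln ((x + y) / 2 / x) <= 0.
Proof.
move=> x0 /andP[y0 yx].
have r0 : 0 < (x + y) / 2 / x by rewrite !divr_gt0 //; lra.
rewrite ln_le0 ?andbT; last by rewrite ler_pdivrMr //; lra.
rewrite -ler_expR lnK ?posrE // ler_pdivlMr // expRN.
have e2 : 2 <= expR 1 :> R by have := expR_ge1Dx (1 : R); lra.
have : (expR 1)^-1 <= 2^-1 :> R by rewrite lef_pV2 ?posrE ?expR_gt0.
by move=> h; nra.
Qed.

Section OptimalCoupling.
Variables (R : realType) (L : finType) (p q : L -> R).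
Hypotheses (p0 : forall a, 0 <= p a) (q0 : forall a, 0 <= q a).
Hypotheses (p1 : \sum_a p a = 1) (q1 : \sum_a q a = 1).

Let m a := Num.min (p a) (q a).
Let tau := \sum_a (p a - m a).
Let nu a := (p a + q a) / 2.

(** At each letter one of the two excesses is 0, so the product term has no mass on the diagonal and
    exactly [tau], the total variation distance, sits off it. If [tau = 0], both excesses vanish and
    the value of the division by 0 is harmless. *)
Definition optimal_coupling (a b : L) : R :=
  (if a == b then m a else 0) + (p a - m a) * (q b - m b) / tau.

Let m_le_p a : m a <= p a. Proof. by rewrite ge_min lexx. Qed.
Let m_le_q a : m a <= q a. Proof. by rewrite ge_min lexx orbT. Qed.
Let m_ge0 a : 0 <= m a. Proof. by rewrite le_min p0 q0. Qed.
Let dp_ge0 a : 0 <= p a - m a. Proof. by rewrite subr_ge0. Qed.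
Let dq_ge0 a : 0 <= q a - m a. Proof. by rewrite subr_ge0. Qed.
Let disjoint_excess a : (p a - m a) * (q a - m a) = 0.
Proof.
by rewrite /m; case: leP => _; rewrite subrr ?mul0r ?mulr0.
Qed.
Let tauE : \sum_a (q a - m a) = tau.
Proof. by rewrite /tau !sumrB p1 q1. Qed.
Let tau_ge0 : 0 <= tau. Proof. exact: sumr_ge0. Qed.

Let tau0_dp a : tau = 0 -> p a - m a = 0.
Proof.
move=> t0; apply/eqP; move/eqP: t0; rewrite psumr_eq0 //.
by move=> /allP/(_ a (mem_index_enum a)).
Qed.
Let tau0_dq a : tau = 0 -> q a - m a = 0.
Proof.
move=> t0; apply/eqP; move/eqP: t0; rewrite -tauE psumr_eq0 //.
by move=> /allP/(_ a (mem_index_enum a)).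
Qed.

Lemma optimal_coupling_ge0 a b : 0 <= optimal_coupling a b.
Proof. by rewrite addr_ge0 ?divr_ge0 ?mulr_ge0 //; case: ifP. Qed.

Lemma optimal_coupling_marginall a : \sum_b optimal_coupling a b = p a.
Proof.
rewrite big_split /= -big_mkcond (big_pred1 a) => [|b]; last by rewrite eq_sym.
rewrite -mulr_suml -mulr_sumr tauE.
have [t0|t0] := eqVneq tau 0; last by rewrite mulfK // subrKC.
by rewrite tau0_dp // !mul0r addr0 -[RHS](subrK (m a)) tau0_dp // add0r.
Qed.

Lemma optimal_coupling_marginalr b : \sum_a optimal_coupling a b = q b.
Proof.
rewrite big_split /= -big_mkcond (big_pred1 b) //.
rewrite -mulr_suml -mulr_suml -/tau.
have [t0|t0] := eqVneq tau 0; last by rewrite mulrAC divff // mul1r subrKC.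
by rewrite tau0_dq // !(mulr0, mul0r) addr0 -[RHS](subrK (m b)) tau0_dq // add0r.
Qed.

Let sum_excess (f g : L -> R) :
  \sum_a \sum_b (p a - m a) * (q b - m b) / tau * (f a + g b) =
  \sum_a (p a - m a) * f a + \sum_b (q b - m b) * g b.
Proof.
have [t0|t0] := eqVneq tau 0.
  rewrite !big1 ?addr0 // => a _; try by rewrite ?tau0_dp ?tau0_dq ?mul0r.
  by rewrite big1 // => b _; rewrite tau0_dp // !mul0r.
transitivity (\sum_a ((p a - m a) * f a + (p a - m a) / tau * \sum_b (q b - m b) * g b)).
  apply: eq_bigr => a _; rewrite mulr_sumr.
  under eq_bigr do rewrite mulrDr.
  rewrite big_split /=; congr (_ + _).
    by rewrite -!mulr_suml -mulr_sumr tauE mulfK.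
  by apply: eq_bigr => b _; ring.
by rewrite big_split /= -mulr_suml -mulr_suml -/tau divff // mul1r.
Qed.

(** Cauchy-Schwarz in linearized form: with [z = |p a - q a|], each term is at least
    [tau * z - tau ^+ 2 * nu a] by completing a square. The [z] sum to [2 * tau] and the [nu a] to
    1. *)
Lemma total_variation_sqr_le : tau ^+ 2 <= \sum_a (p a - q a) ^+ 2 / (4 * nu a).
Proof.
apply: (@le_trans _ _ (\sum_a (tau * ((p a - m a) + (q a - m a)) - tau ^+ 2 * nu a))).
  rewrite sumrB -!mulr_sumr big_split /= tauE -/tau -mulr_suml big_split /= p1 q1.
  by rewrite le_eqVlt; apply/orP; left; apply/eqP; field.
apply: ler_sum => a _.
have nu_ge0 : 0 <= nu a by rewrite /nu divr_ge0 ?addr_ge0.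
have zE : (p a - q a) ^+ 2 = (p a - m a + (q a - m a)) ^+ 2.
  by rewrite /m; case: leP => _; ring.
rewrite zE; set z := _ + (q a - m a).
have [n0|n0] := eqVneq (nu a) 0.
  have /eqP : p a + q a = 0 by move: n0; rewrite /nu; lra.
  rewrite paddr_eq0 // => /andP[/eqP pa /eqP qa].
  by rewrite /z /m pa qa minxx subrr addr0 n0 !mulr0 invr0 mulr0 subrr.
have n_gt0 : 0 < nu a by rewrite lt_neqAle eq_sym n0.
rewrite -subr_ge0.
have -> : z ^+ 2 / (4 * nu a) - (tau * z - tau ^+ 2 * nu a) =
  (z - 2 * tau * nu a) ^+ 2 / (4 * nu a) by field.
by rewrite divr_ge0 ?sqr_ge0 // mulr_ge0.
Qed.

Let nu_gt0 a : 0 < p a -> 0 < nu a.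
Proof. by move=> pa; rewrite /nu; have := q0 a; lra. Qed.

(** The exponent [l = ln (nu ^+ 2 / (p * q))] is nonnegative by AM-GM, so [expR_div_le] applies.
    Although [l] can be large, [m a * (expR l - 1)] equals [(p - q) ^+ 2 / (4 * max(p, q))], which
    is at most a quarter of the excess at [a]. *)
Let diag_bound (N : nat) a : (0 < N)%N ->
  m a * expR ((ln (nu a / p a) + ln (nu a / q a)) / N%:R) <=
  m a + m a * (ln (nu a / p a) + ln (nu a / q a)) / N%:R
  + (p a - m a + (q a - m a)) / 2 / N%:R ^+ 2.
Proof.
move=> N0; have n0 : 0 < N%:R :> R by rewrite ltr0n.
have [mz|mn0] := eqVneq (m a) 0.
  rewrite mz !subr0 !mul0r !add0r; apply: divr_ge0; last by rewrite exprn_ge0 ?ltW.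
  by apply: divr_ge0 => //; exact: addr_ge0.
have m_gt0 : 0 < m a by rewrite lt_neqAle eq_sym mn0 m_ge0.
have pa := lt_le_trans m_gt0 (m_le_p a).
have qa := lt_le_trans m_gt0 (m_le_q a).
have na := nu_gt0 pa.
set l := ln _ + _.
have el : expR l = nu a ^+ 2 / (p a * q a).
  have [rp rq] := (divr_gt0 na pa, divr_gt0 na qa).
  by rewrite /l expRD !lnK //; field; rewrite !gt_eqF.
have pq : 0 < p a * q a by rewrite mulr_gt0.
have l0 : 0 <= l.
  rewrite -ler_expR expR0 el ler_pdivlMr // mul1r -subr_ge0.
  have -> : nu a ^+ 2 - p a * q a = ((p a - q a) / 2) ^+ 2 by rewrite /nu; field.
  exact: sqr_ge0.
have key : m a * (expR l - 1) <= (p a - m a + (q a - m a)) / 4.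
  rewrite el /m /nu; case: (leP (p a) (q a)) => h.
    have -> : p a * (((p a + q a) / 2) ^+ 2 / (p a * q a) - 1) =
      (q a - p a) ^+ 2 / (4 * q a) by field; rewrite !gt_eqF.
    by rewrite subrr add0r ler_pdivrMr ?mulr_gt0 //; nra.
  have -> : q a * (((p a + q a) / 2) ^+ 2 / (p a * q a) - 1) =
    (p a - q a) ^+ 2 / (4 * p a) by field; rewrite !gt_eqF.
  by rewrite subrr addr0 ler_pdivrMr ?mulr_gt0 //; nra.
apply: (le_trans (ler_wpM2l (m_ge0 a) (expR_div_le N0 l0))).
have -> : m a * (1 + l / N%:R + 2 * (expR l - 1) / N%:R ^+ 2) =
  m a + m a * l / N%:R + (m a * (expR l - 1)) * 2 / N%:R ^+ 2.
  by field; rewrite gt_eqF.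
rewrite lerD2l ler_pM2r ?invr_gt0 ?exprn_gt0 //.
by lra.
Qed.

(** Where the product term is nonzero, both logarithms lie in [-1, 0], so the numerator of the
    exponent lies in [-2, 2]. With [6 <= N] the exponent is at most 1/3, as [expR_le_quadratic]
    requires. The bound is a sum of a function of [a] and one of [b], the shape that [sum_excess]
    integrates. *)
Let off_bound (N : nat) (mu : R) a b : (6 <= N)%N -> 0 <= mu <= 1 ->
  (p a - m a) * (q b - m b) / tau *
     expR ((2 * mu + (ln (nu a / p a) + ln (nu b / q b))) / N%:R) <=
  (p a - m a) * (q b - m b) / tau *
     ((1 + 2 * mu / N%:R + 4 / N%:R ^+ 2 + ln (nu a / p a) / N%:R)
      + ln (nu b / q b) / N%:R).
Proof.
move=> N6 /andP[mu0 mu1].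
have n6 : 6 <= N%:R :> R by rewrite ler_nat.
have n0 : 0 < N%:R :> R by lra.
have [pa|pa] := eqVneq (p a - m a) 0; first by rewrite pa !mul0r.
have [qb|qb] := eqVneq (q b - m b) 0; first by rewrite qb !(mulr0, mul0r).
apply: ler_wpM2l; first by rewrite divr_ge0 ?mulr_ge0.
have /andP[la1 la0] : -1 <= ln (nu a / p a) <= 0.
  have pq : q a < p a.
    by rewrite ltNge; apply: contra pa => h; rewrite /m min_l // subrr.
  by apply: ln_mean_ratio_bounds; [exact: le_lt_trans pq | rewrite q0 ltW].
have /andP[lb1 lb0] : -1 <= ln (nu b / q b) <= 0.
  have qp : p b < q b.
    by rewrite ltNge; apply: contra qb => h; rewrite /m min_r // subrr.
  rewrite /nu [p b + _]addrC.
  by apply: ln_mean_ratio_bounds; [exact: le_lt_trans qp | rewrite p0 ltW].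
set x := _ / N%:R.
have x_le : x <= 1 / 3 by rewrite /x ler_pdivrMr //; lra.
apply: (le_trans (expR_le_quadratic x_le)).
have sq : (2 * mu + (ln (nu a / p a) + ln (nu b / q b))) ^+ 2 <= 4 by nra.
have : x ^+ 2 <= 4 / N%:R ^+ 2.
  by rewrite /x expr_div_n ler_pM2r ?invr_gt0 ?exprn_gt0.
have -> : x = 2 * mu / N%:R + ln (nu a / p a) / N%:R + ln (nu b / q b) / N%:R.
  by rewrite /x; field; rewrite gt_eqF.
by lra.
Qed.

(** The first-order terms give [2 * mu * tau / N] and an entropy term of at most [- tau ^+ 2 / N].
    The second-order errors are [4 * tau / N ^+ 2] off the diagonal and [tau / N ^+ 2] on it, whence
    the shift of [mu] by [5 / (2 * N)]. The bound is the maximum over [tau] of the resulting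
    quadratic. *)
Lemma optimal_coupling_moment (N : nat) (mu : R) : (6 <= N)%N -> 0 <= mu <= 1 ->
  \sum_a \sum_b optimal_coupling a b *
    expR (((if a == b then 0 else 2 * mu)
           + (ln (nu a / p a) + ln (nu b / q b))) / N%:R)
  <= 1 + (mu + 5 / (2 * N%:R)) ^+ 2 / N%:R.
Proof.
move=> N6 mu01.
have n0 : 0 < N%:R :> R by rewrite ltr0n; exact: leq_trans N6.
set D := \sum_a (m a + m a * (ln (nu a / p a) + ln (nu a / q a)) / N%:R
  + (p a - m a + (q a - m a)) / 2 / N%:R ^+ 2).
set O := \sum_a \sum_b (p a - m a) * (q b - m b) / tau *
     ((1 + 2 * mu / N%:R + 4 / N%:R ^+ 2 + ln (nu a / p a) / N%:R)
      + ln (nu b / q b) / N%:R).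
apply: (@le_trans _ _ (D + O)).
  rewrite /D /O -big_split /=; apply: ler_sum => a _.
  rewrite (bigD1 a) //= [X in _ <= _ + X](bigD1 a) //= disjoint_excess !mul0r add0r.
  rewrite /optimal_coupling eqxx disjoint_excess mul0r addr0 add0r.
  apply: lerD; first by apply: diag_bound; exact: leq_trans N6.
  apply: ler_sum => b ba; rewrite eq_sym (negPf ba) add0r.
  exact: off_bound.
rewrite /O sum_excess.
have -> : D + (\sum_a (p a - m a) *
       (1 + 2 * mu / N%:R + 4 / N%:R ^+ 2 + ln (nu a / p a) / N%:R)
     + \sum_b (q b - m b) * (ln (nu b / q b) / N%:R)) =
   \sum_a p a + (\sum_a (p a - m a)) * (2 * mu / N%:R + (4 + 1 / 2) / N%:R ^+ 2)
   + (\sum_a (q a - m a)) * (1 / 2 / N%:R ^+ 2)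
   + (\sum_a (p a * ln (nu a / p a) + q a * ln (nu a / q a))) / N%:R.
  rewrite /D !mulr_suml -!big_split /=; apply: eq_bigr => a _.
  by field; rewrite gt_eqF.
rewrite tauE -/tau p1.
have js : \sum_a (p a * ln (nu a / p a) + q a * ln (nu a / q a)) <= - tau ^+ 2.
  apply: (@le_trans _ _ (- \sum_a (p a - q a) ^+ 2 / (4 * nu a))).
    by rewrite -sumrN; apply: ler_sum => a _; apply: jensen_shannon_ge.
  by rewrite lerN2 total_variation_sqr_le.
set J := \sum_a _ in js *.
apply: (@le_trans _ _ (1 + (2 * tau * (mu + 5 / (2 * N%:R)) - tau ^+ 2) / N%:R)).
  have -> : 1 + tau * (2 * mu / N%:R + (4 + 1 / 2) / N%:R ^+ 2) +
     tau * (1 / 2 / N%:R ^+ 2) + J / N%:R =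
     1 + (2 * tau * (mu + 5 / (2 * N%:R)) + J) / N%:R.
    by field; rewrite gt_eqF.
  by rewrite lerD2l ler_pM2r ?invr_gt0 // lerD2l.
rewrite lerD2l ler_pM2r ?invr_gt0 //.
by have := sqr_ge0 (tau - (mu + 5 / (2 * N%:R))); rewrite sqrrB; lra.
Qed.

End OptimalCoupling.

(** * The weighted interpolation inequality *)

(** The coupling [pi] is fixed before [w], [phi] and [psi], so that [interpolation_prod] can use one
    coupling on each pair of fibres for all weights. The mass clause assumes positive sums because
    the zero coupling serves when [f] or [g] vanishes. *)
Definition interpolating (R : realType) (X B : finType)
    (mid : B -> X -> X -> X) (om : X -> X -> R) (n : nat) (kappa : R)
    (f g : X -> R) (pi : X -> X -> R) :=
  [/\ forall x y, 0 <= pi x y,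
      0 < \sum_x f x -> 0 < \sum_x g x -> \sum_x \sum_y pi x y = 1,
      forall x y, pi x y != 0 -> 0 < f x /\ 0 < g y &
      forall (w : X -> X -> B -> R) (phi psi : X -> R),
        (forall x y b, 0 <= w x y b) ->
        (forall x, 0 <= phi x) -> (forall x, 0 <= psi x) ->
        (forall x y b, w x y b ^+ n * (f x * g y)
                       <= phi (mid b x y) * psi (mid b y x)) ->
        (\sum_x \sum_y pi x y * (om x y * (#|B|%:R^-1 * \sum_b w x y b))) ^+ n
          * ((\sum_x f x) * \sum_x g x)
        <= kappa * ((\sum_x phi x) * \sum_x psi x)].

Definition interpolation_inequality (R : realType) (X B : finType)
    (mid : B -> X -> X -> X) (om : X -> X -> R) (n : nat) (kappa : R) :=
  forall f g : X -> R, (forall x, 0 <= f x) -> (forall x, 0 <= g x) ->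
  exists pi, interpolating mid om n kappa f g pi.

Lemma interpolating0 (R : realType) (X B : finType)
    (mid : B -> X -> X -> X) (om : X -> X -> R) (n : nat) (kappa : R)
    (f g : X -> R) : 0 <= kappa ->
  (\sum_x f x) * (\sum_x g x) = 0 ->
  interpolating mid om n kappa f g (fun _ _ => 0).
Proof.
move=> k0 h; split=> //.
- by move=> F0 G0; move/eqP: h; rewrite gt_eqF // mulr_gt0.
- by move=> x y; rewrite eqxx.
- by move=> w phi psi _ p0 s0 _; rewrite h mulr0 !mulr_ge0 ?sumr_ge0.
Qed.

Lemma root_exists (R : realType) (n : nat) (x : R) : (0 < n)%N -> 0 < x ->
  exists2 c : R, 0 < c & c ^+ n = x.
Proof.
move=> n0 x0; exists (expR (ln x / n%:R)); first exact: expR_gt0.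
by rewrite -expRM_natr divfK ?lnK // pnatr_eq0 -lt0n.
Qed.

Lemma sumr_eq0_eq0 (R : realType) (X : finType) (f : X -> R) :
  (forall x, 0 <= f x) -> \sum_x f x <= 0 -> forall x, f x = 0.
Proof.
move=> f0 s0 x; apply/eqP; rewrite eq_le f0 andbT.
by apply: le_trans s0; rewrite (bigD1 x) //= lerDl sumr_ge0.
Qed.

Lemma sumr_gt0_or0 (R : realType) (X : finType) (f : X -> R) :
  (forall x, 0 <= f x) -> 0 < \sum_x f x \/ forall x, f x = 0.
Proof.
by move=> f0; have [h|] := ltP 0 (\sum_x f x); [left | right; exact: sumr_eq0_eq0].
Qed.

(** The functions [phi] and [psi] become densities [U] and [V] with respect to [nu], and [om]
    together with the ratios [nu / p] and [nu / q] becomes [z ^+ N]. Averaged over the bit, [U] and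
    [V] have mean at most 1 under [pi], and [optimal_coupling_moment] bounds the mean of [z] by [K],
    which yields [K ^+ N]. *)
Lemma letter_interpolation (R : realType) (L : finType) (N : nat) (mu : R) :
  (6 <= N)%N -> 0 <= mu <= 1 ->
  @interpolation_inequality R L bool (fun b x y => if b then y else x)
    (fun x y => if x == y then 1 else expR (2 * mu / N.+2%:R)) N.+2
    ((1 + (mu + 5 / (2 * N%:R)) ^+ 2 / N%:R) ^+ N).
Proof.
move=> N6 mu01 f g f0 g0.
have N0 : 0 < N%:R :> R by rewrite ltr0n; exact: leq_trans N6.
have n0 : 0 < N.+2%:R :> R by rewrite ltr0n.
set K := 1 + _.
have K0 : 0 < K.
  by rewrite /K ltr_wpDr // divr_ge0 ?sqr_ge0 // ltW.
have kappa0 : 0 <= K ^+ N by rewrite exprn_ge0 // ltW.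
have [F0|fz] := sumr_gt0_or0 f0; last first.
  by exists (fun _ _ => 0); apply: interpolating0; rewrite // big1 ?mul0r.
have [G0|gz] := sumr_gt0_or0 g0; last first.
  by exists (fun _ _ => 0); apply: interpolating0; rewrite // [X in _ * X]big1 ?mulr0.
set F := \sum_x f x in F0 *; set G := \sum_x g x in G0 *.
pose p x := f x / F; pose q x := g x / G.
have p0 x : 0 <= p x by rewrite divr_ge0 // ltW.
have q0 x : 0 <= q x by rewrite divr_ge0 // ltW.
have p1 : \sum_x p x = 1 by rewrite -mulr_suml divff // gt_eqF.
have q1 : \sum_x q x = 1 by rewrite -mulr_suml divff // gt_eqF.
have pi0 := optimal_coupling_ge0 p0 q0.
have pil := optimal_coupling_marginall p1 q1.
have pir := optimal_coupling_marginalr p1 q1.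
have mom := optimal_coupling_moment p0 q0 p1 q1 N6 mu01.
set pi := optimal_coupling p q in pi0 pil pir mom *.
clearbody pi.
have pi_p a b : pi a b != 0 -> 0 < p a.
  move=> h; rewrite -pil; apply: (@lt_le_trans _ _ (pi a b)).
    by rewrite lt_neqAle eq_sym h pi0.
  by rewrite (bigD1 b) //= lerDl sumr_ge0.
have pi_q a b : pi a b != 0 -> 0 < q b.
  move=> h; rewrite -pir; apply: (@lt_le_trans _ _ (pi a b)).
    by rewrite lt_neqAle eq_sym h pi0.
  by rewrite (bigD1 a) //= lerDl sumr_ge0.
have fE x : f x = F * p x by rewrite mulrC divfK // gt_eqF.
have gE x : g x = G * q x by rewrite mulrC divfK // gt_eqF.
exists pi; split=> //.
- by move=> _ _; rewrite -p1; apply: eq_bigr => a _; exact: pil.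
- move=> x y h; rewrite fE gE.
  by split; apply: mulr_gt0 => //; [exact: pi_p _ _ h | exact: pi_q _ _ h].
move=> w phi psi w0 phi0 psi0 H.
(* If [phi] or [psi] vanishes identically, [H] forces [w = 0] on the support of [pi]. *)
have vanish : (forall a b e, phi (if e then b else a) * psi (if e then a else b) = 0) ->
    \sum_x \sum_y pi x y * ((if x == y then 1 else expR (2 * mu / N.+2%:R))
            * (#|{: bool}|%:R^-1 * \sum_b w x y b)) = 0.
  move=> z; apply: big1 => a _; apply: big1 => b _.
  have [->|h] := eqVneq (pi a b) 0; first by rewrite mul0r.
  rewrite [\sum_ _ _]big1 ?mulr0 // => e _; apply/eqP.
  rewrite -[_ == 0]andTb -[true]/(0 < N.+2)%N -expf_eq0 eq_le exprn_ge0 // andbT.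
  have fg : 0 < f a * g b.
    have pa := pi_p _ _ h; have qb := pi_q _ _ h; rewrite fE gE.
    exact: mulr_gt0 (mulr_gt0 F0 pa) (mulr_gt0 G0 qb).
  by rewrite -(pmulr_lle0 _ fg); apply: le_trans (H a b e) _; rewrite z.
have rhs0 : 0 <= K ^+ N * ((\sum_x phi x) * \sum_x psi x).
  by rewrite !mulr_ge0 ?exprn_ge0 ?sumr_ge0 // ltW.
have [Ph0|pz] := sumr_gt0_or0 phi0; last first.
  by rewrite vanish ?expr0n ?mul0r // => a b e; rewrite pz mul0r.
have [Ps0|pz] := sumr_gt0_or0 psi0; last first.
  by rewrite vanish ?expr0n ?mul0r // => a b e; rewrite pz mulr0.
clear vanish rhs0.
set Ph := \sum_x phi x in Ph0 *; set Ps := \sum_x psi x in Ps0 *.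
have FG : 0 < F * G by rewrite mulr_gt0.
(* After taking this root it remains to bound the weighted mean by [c]. *)
have [c c0 cE] := @root_exists R N.+2 (K ^+ N * (Ph * Ps) / (F * G)) isT
  ltac:(by rewrite divr_gt0 // !mulr_gt0 // exprn_gt0).
pose nu a := (p a + q a) / 2.
have nu_p a : 0 < p a -> 0 < nu a by move=> h; rewrite /nu; have := q0 a; lra.
have nu_q a : 0 < q a -> 0 < nu a by move=> h; rewrite /nu; have := p0 a; lra.
have nu0 a : 0 <= nu a by rewrite /nu divr_ge0 ?addr_ge0.
pose U a := phi a / Ph / nu a; pose V a := psi a / Ps / nu a.
have U0 a : 0 <= U a by rewrite /U divr_ge0 // divr_ge0 // ltW.
have V0 a : 0 <= V a by rewrite /V divr_ge0 // divr_ge0 // ltW.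
pose z (a b : L) : R := expR (((if a == b then 0 else 2 * mu)
           + (ln (nu a / p a) + ln (nu b / q b))) / N%:R).
pose Z a b := z a b / K.
have Z0 a b : 0 <= Z a b by rewrite divr_ge0 ?expR_ge0 // ltW.
pose om (a b : L) : R := if a == b then 1 else expR (2 * mu / N.+2%:R).
have om0 a b : 0 <= om a b by rewrite /om; case: ifP => // _; exact: expR_ge0.
pose M a b (e : bool) :=
  (U (if e then b else a) + V (if e then a else b) + N%:R * Z a b) / N.+2%:R.
have M0 a b e : 0 <= M a b e.
  by rewrite /M divr_ge0 ?ler0n // !addr_ge0 // mulr_ge0 // ltW.
(* Hoelder's inequality with exponents n, n and n / N, in the form of the weighted
   AM-GM inequality for the normalized factors U, V and Z. *)
have point a b e : pi a b != 0 -> om a b * w a b e <= c * M a b e.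
  move=> h; have pa := pi_p _ _ h; have qb := pi_q _ _ h.
  have na := nu_p _ pa; have nb := nu_q _ qb.
  have c1 := ltW c0.
  suff : (om a b * w a b e) ^+ N.+2 <= (c * M a b e) ^+ N.+2.
    by rewrite ler_pXn2r // nnegrE mulr_ge0.
  rewrite exprMn [leRHS]exprMn.
  apply: (@le_trans _ _ (c ^+ N.+2 * (U (if e then b else a) *
      V (if e then a else b) * Z a b ^+ N))); last first.
    by rewrite ler_wpM2l ?exprn_ge0 ?(ltW c0) // weighted_AGM.
  have zE : z a b ^+ N = om a b ^+ N.+2 * (nu a / p a) * (nu b / q b).
    have [ra rb] := (divr_gt0 na pa, divr_gt0 nb qb).
    rewrite /z -expRM_natl [N%:R * _]mulrC divfK ?gt_eqF // !expRD !lnK //.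
    rewrite mulrA /om; case: eqP => _; first by rewrite expR0 expr1n.
    by rewrite -expRM_natl [N.+2%:R * _]mulrC divfK ?gt_eqF.
  rewrite cE /Z exprMn zE exprVn.
  have fg : 0 < f a * g b.
    rewrite fE gE; exact: mulr_gt0 (mulr_gt0 F0 pa) (mulr_gt0 G0 qb).
  have HH : w a b e ^+ N.+2 <=
      phi (if e then b else a) * psi (if e then a else b) / (f a * g b).
    by rewrite ler_pdivlMr.
  apply: le_trans (ler_wpM2l _ HH) _; first by rewrite exprn_ge0.
  rewrite le_eqVlt; apply/orP; left; apply/eqP.
  rewrite fE gE /U /V; set o := om a b ^+ N.+2; set k := K ^+ N.
  have k0 : k != 0 by rewrite expf_neq0 // gt_eqF.
  by clear HH; case: e; field; rewrite k0 !gt_eqF.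
(* A uniform choice between the two letters of the coupling has law [nu]. The mean can be less than
   1 because [ph] may have mass where [nu] is 0. *)
have EU (W : L -> R) (ph : L -> R) (S : R) : 0 < S -> \sum_x ph x = S ->
    (forall x, 0 <= ph x) -> W = (fun a => ph a / S / nu a) ->
    \sum_a \sum_b pi a b * ((W a + W b) / 2) <= 1.
  move=> S0 phS ph0 ->.
  have -> : \sum_a \sum_b pi a b * ((ph a / S / nu a + ph b / S / nu b) / 2)
     = \sum_a ph a / S / nu a * nu a.
    under eq_bigr do under eq_bigr do rewrite mulrDl mulrDr.
    under eq_bigr do rewrite big_split /= -mulr_suml pil.
    rewrite big_split /= exchange_big /=.
    under [X in _ + X]eq_bigr do rewrite -mulr_suml pir.
    by rewrite -big_split /=; apply: eq_bigr => a _; rewrite /nu; ring.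
  have -> : 1 = \sum_x ph x / S by rewrite -mulr_suml phS divff // gt_eqF.
  apply: ler_sum => a _; have [->|h] := eqVneq (nu a) 0.
    by rewrite mulr0 divr_ge0 // ltW.
  by rewrite divfK.
have total : \sum_a \sum_b pi a b * (om a b * (#|{: bool}|%:R^-1 * \sum_e w a b e)) <= c.
  apply: (@le_trans _ _ (\sum_a \sum_b pi a b * (c * ((M a b true + M a b false) / 2)))).
    apply: ler_sum => a _; apply: ler_sum => b _.
    have [->|h] := eqVneq (pi a b) 0; first by rewrite !mul0r.
    apply: ler_wpM2l => //; rewrite big_bool card_bool /=.
    by have := point a b true h; have := point a b false h; lra.
  have -> : \sum_a \sum_b pi a b * (c * ((M a b true + M a b false) / 2)) =
    c * ((\sum_a \sum_b pi a b * ((U a + U b) / 2)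
          + \sum_a \sum_b pi a b * ((V a + V b) / 2)
          + N%:R / K * \sum_a \sum_b pi a b * z a b) / N.+2%:R).
    rewrite mulr_sumr -!big_split /= mulr_suml mulr_sumr; apply: eq_bigr => a _.
    rewrite mulr_sumr -!big_split /= mulr_suml mulr_sumr; apply: eq_bigr => b _.
    by rewrite /M /Z; field; rewrite !gt_eqF.
  rewrite -[leRHS]mulr1 ler_pM2l // ler_pdivrMr // mul1r.
  have := EU U phi Ph Ph0 erefl phi0 erefl.
  have := EU V psi Ps Ps0 erefl psi0 erefl.
  have : N%:R / K * (\sum_a \sum_b pi a b * z a b) <= N%:R.
    by rewrite mulrAC ler_pdivrMr // ler_pM2l.
  by rewrite -[N.+2%:R]natr1 -[N.+1%:R]natr1; lra.
rewrite -ler_pdivlMr // -cE.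
apply: lerXn2r total; rewrite nnegrE ?(ltW c0) //.
apply: sumr_ge0 => a _; apply: sumr_ge0 => b _.
by rewrite !mulr_ge0 ?invr_ge0 ?sumr_ge0.
Qed.

Lemma big_prod_pair (R : realType) (I J : finType) (F : I * J -> R) :
  \sum_p F p = \sum_i \sum_j F (i, j).
Proof. by rewrite pair_bigA; apply: eq_bigr => -[]. Qed.

(** Tensorization as for the Prekopa-Leindler inequality: couple the first coordinates using the
    marginal sums [f1] and [g1], then couple the fibres over each pair. The fibre inequality says
    that the averaged weight [w1] satisfies the hypothesis for the first factor, once [kappa2] is
    absorbed into [phi1]. *)
Lemma interpolation_prod (R : realType) (X1 B1 X2 B2 : finType)
    (mid1 : B1 -> X1 -> X1 -> X1) (mid2 : B2 -> X2 -> X2 -> X2)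
    (om1 : X1 -> X1 -> R) (om2 : X2 -> X2 -> R) (n : nat) (kappa1 kappa2 : R) :
  0 <= kappa2 -> (forall x y, 0 <= om2 x y) ->
  interpolation_inequality mid1 om1 n kappa1 ->
  interpolation_inequality mid2 om2 n kappa2 ->
  interpolation_inequality (X := (X1 * X2)%type) (B := (B1 * B2)%type)
    (fun b x y => (mid1 b.1 x.1 y.1, mid2 b.2 x.2 y.2))
    (fun x y => om1 x.1 y.1 * om2 x.2 y.2) n (kappa1 * kappa2).
Proof.
move=> k2 om2_ge0 H1 H2 f g f0 g0.
pose f1 a := \sum_x f (a, x); pose g1 a := \sum_x g (a, x).
have f10 a : 0 <= f1 a by apply: sumr_ge0.
have g10 a : 0 <= g1 a by apply: sumr_ge0.
have [pi1 [pi1_ge0 pi1_1 pi1_supp pi1P]] := H1 f1 g1 f10 g10.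
pose H2' (ab : X1 * X1) := cid (H2 (fun x => f (ab.1, x)) (fun x => g (ab.2, x))
  (fun x => f0 (ab.1, x)) (fun x => g0 (ab.2, x))).
pose pi2 a b := projT1 (H2' (a, b)).
have pi2P a b : interpolating mid2 om2 n kappa2 (fun x => f (a, x))
  (fun x => g (b, x)) (pi2 a b) := projT2 (H2' (a, b)).
clearbody pi2; clear H2'.
exists (fun x y => pi1 x.1 y.1 * pi2 x.1 y.1 x.2 y.2); split.
- by move=> x y; have [h _ _ _] := pi2P x.1 y.1; rewrite mulr_ge0.
- rewrite !big_prod_pair => F0 G0; rewrite -(pi1_1 F0 G0).
  apply: eq_bigr => a _.
  under eq_bigr do rewrite big_prod_pair.
  rewrite exchange_big; apply: eq_bigr => b _ /=.
  have [->|h] := eqVneq (pi1 a b) 0.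
    by rewrite big1 // => x _; rewrite big1 // => y _; rewrite mul0r.
  have [fa gb] := pi1_supp _ _ h.
  under eq_bigr do rewrite -mulr_sumr.
  by rewrite -mulr_sumr; have [_ -> // _ _] := pi2P a b; rewrite mulr1.
- move=> [a x] [b y] /=; rewrite mulf_eq0 negb_or => /andP[_ h].
  by have [_ _ supp _] := pi2P a b; exact: supp.
move=> w phi psi w0 phi0 psi0 H.
pose w1 a b e := \sum_x \sum_y pi2 a b x y *
  (om2 x y * (#|B2|%:R^-1 * \sum_e2 w (a, x) (b, y) (e, e2))).
pose phi1 a := kappa2 * \sum_x phi (a, x); pose psi1 a := \sum_x psi (a, x).
have w10 a b e : 0 <= w1 a b e.
  apply: sumr_ge0 => x _; apply: sumr_ge0 => y _; have [h _ _ _] := pi2P a b.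
  by rewrite !mulr_ge0 ?invr_ge0 ?sumr_ge0.
have phi10 a : 0 <= phi1 a by rewrite mulr_ge0 ?sumr_ge0.
have psi10 a : 0 <= psi1 a by rewrite sumr_ge0.
have H1' a b e : w1 a b e ^+ n * (f1 a * g1 b) <= phi1 (mid1 e a b) * psi1 (mid1 e b a).
  case: (pi2P a b) => _ _ _ h; rewrite /phi1 -mulrA.
  by apply: (h (fun x y e2 => w (a, x) (b, y) (e, e2))
    (fun x => phi (mid1 e a b, x)) (fun x => psi (mid1 e b a, x))).
have E : \sum_x \sum_y pi1 x.1 y.1 * pi2 x.1 y.1 x.2 y.2 *
      (om1 x.1 y.1 * om2 x.2 y.2 * (#|{: B1 * B2}|%:R^-1 * \sum_b w x y b)) =
    \sum_a \sum_b pi1 a b * (om1 a b * (#|B1|%:R^-1 * \sum_e w1 a b e)).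
  rewrite big_prod_pair; apply: eq_bigr => a _.
  under eq_bigr do rewrite big_prod_pair.
  rewrite exchange_big; apply: eq_bigr => b _ /=.
  rewrite /w1 [in RHS]exchange_big /=; do 3! rewrite [in RHS]mulr_sumr.
  apply: eq_bigr => x _.
  rewrite [in RHS]exchange_big /=; do 3! rewrite [in RHS]mulr_sumr.
  apply: eq_bigr => y _.
  rewrite big_prod_pair card_prod natrM invfM -!mulr_sumr; ring.
have := pi1P w1 phi1 psi1 w10 phi10 psi10 H1'.
rewrite E [\sum_x f x]big_prod_pair [\sum_x g x]big_prod_pair.
by rewrite [\sum_x phi x]big_prod_pair [\sum_x psi x]big_prod_pair -mulr_sumr !mulrA.
Qed.

Lemma interpolation_transport (R : realType) (X B X' B' : finType)
    (mid : B -> X -> X -> X) (mid' : B' -> X' -> X' -> X')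
    (om : X -> X -> R) (om' : X' -> X' -> R) (n : nat) (kappa : R)
    (h : X -> X') (k : B -> B') : bijective h -> bijective k ->
  (forall b x y, h (mid b x y) = mid' (k b) (h x) (h y)) ->
  (forall x y, om x y = om' (h x) (h y)) ->
  interpolation_inequality mid om n kappa ->
  interpolation_inequality mid' om' n kappa.
Proof.
move=> hb kb hmid hom H f g f0 g0.
have reX (F : X' -> R) : \sum_x F x = \sum_x F (h x).
  by rewrite (reindex h) //; exact: onW_bij.
have reB (F : B' -> R) : \sum_x F x = \sum_x F (k x).
  by rewrite (reindex k) //; exact: onW_bij.
have [h' hK h'K] := hb.
have [pi [p0 p1 ps pP]] := H (f \o h) (g \o h) (fun x => f0 (h x)) (fun x => g0 (h x)).
exists (fun x y => pi (h' x) (h' y)); split=> //.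
- rewrite !reX => F0 G0; rewrite -(p1 F0 G0); apply: eq_bigr => x _.
  by rewrite reX; apply: eq_bigr => y _; rewrite !hK.
- by move=> x y /ps /=; rewrite !h'K.
move=> w phi psi w0 phi0 psi0 Hw.
have := pP (fun x y b => w (h x) (h y) (k b)) (phi \o h) (psi \o h)
  (fun x y b => w0 _ _ _) (fun x => phi0 _) (fun x => psi0 _).
have Hw' x y b : w (h x) (h y) (k b) ^+ n * ((f \o h) x * (g \o h) y)
    <= (phi \o h) (mid b x y) * (psi \o h) (mid b y x).
  by rewrite /= !hmid.
move=> /(_ Hw'); rewrite [\sum_x phi x]reX [\sum_x psi x]reX.
rewrite [\sum_x f x]reX [\sum_x g x]reX.
congr (_ ^+ n * _ <= _); rewrite reX; apply: eq_bigr => x _.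
rewrite reX; apply: eq_bigr => y _.
by rewrite !hK hom reB (bij_eq_card kb).
Qed.

Definition fcons (T : finType) (d : nat) (p : T * {ffun 'I_d -> T}) :
    {ffun 'I_d.+1 -> T} :=
  [ffun i => if unlift ord0 i is Some j then p.2 j else p.1].

Lemma fcons_bij (T : finType) (d : nat) : bijective (@fcons T d).
Proof.
exists (fun x : {ffun 'I_d.+1 -> T} =>
  (x ord0, [ffun j : 'I_d => x (lift ord0 j)] : {ffun 'I_d -> T})).
  case=> a x; rewrite /fcons ffunE unlift_none; congr pair.
  by apply/ffunP => j; rewrite !ffunE liftK.
by move=> x; apply/ffunP => i; rewrite ffunE; case: unliftP => [j|] -> //=; rewrite ffunE.
Qed.

Definition fmix (T : finType) (d : nat) (A : {ffun 'I_d -> bool})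
    (s t : {ffun 'I_d -> T}) : {ffun 'I_d -> T} :=
  [ffun i => if A i then t i else s i].

Lemma ffun_interpolation (R : realType) (L : finType) (N : nat) (mu : R) (d : nat) :
  (6 <= N)%N -> 0 <= mu <= 1 ->
  interpolation_inequality (@fmix L d)
    (fun s t => expR (2 * mu / N.+2%:R) ^+ #|[pred i | s i != t i]|) N.+2
    ((1 + (mu + 5 / (2 * N%:R)) ^+ 2 / N%:R) ^+ N ^+ d).
Proof.
move=> N6 mu01; set gam := expR _; set kap := _ ^+ N.
have gam0 : 0 <= gam by exact: expR_ge0.
have kap0 : 0 <= kap.
  by rewrite exprn_ge0 // addr_ge0 // divr_ge0 // sqr_ge0.
elim: d => [|d IH].
  move=> f g f0 g0.
  have uniq0 (T : Type) (x y : {ffun 'I_0 -> T}) : x = y.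
    by apply/ffunP; case.
  have sum1 (T : finType) (x : {ffun 'I_0 -> T}) (F : {ffun 'I_0 -> T} -> R) :
      \sum_y F y = F x.
    by rewrite (big_pred1 x) // => y; apply/esym/eqP; exact: uniq0.
  pose x0 : {ffun 'I_0 -> L} := ffun0 (card_ord 0).
  have [[fz|gz]|[fp gp]] : (f x0 = 0 \/ g x0 = 0) \/ (0 < f x0 /\ 0 < g x0).
    have := f0 x0; rewrite le_eqVlt => /orP[/eqP <-|fp]; first by left; left.
    have := g0 x0; rewrite le_eqVlt => /orP[/eqP <-|gp]; first by left; right.
    by right.
  - exists (fun _ _ => 0); apply: interpolating0; rewrite ?expr0 //.
    by rewrite (sum1 _ x0) fz mul0r.
  - exists (fun _ _ => 0); apply: interpolating0; rewrite ?expr0 //.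
    by rewrite [X in _ * X](sum1 _ x0) gz mulr0.
  exists (fun _ _ => 1); split=> //.
  - by move=> _ _; rewrite !(sum1 _ x0).
  - by move=> x y _; rewrite (uniq0 _ x x0) (uniq0 _ y x0).
  move=> w phi psi w0 phi0 psi0 H.
  pose b0 : {ffun 'I_0 -> bool} := ffun0 (card_ord 0).
  rewrite !(sum1 _ x0) (sum1 _ b0) card_ffun card_ord expn0 invr1 !mul1r.
  rewrite eq_card0 ?expr0 ?mul1r; last by case.
  by apply: le_trans (H x0 x0 b0) _; rewrite (uniq0 _ (fmix _ _ _) x0).
have step := interpolation_prod (exprn_ge0 d kap0) (fun x y => exprn_ge0 _ gam0)
  (letter_interpolation (L := L) N6 mu01) IH.
rewrite exprS; apply: (interpolation_transport (fcons_bij L d) (fcons_bij bool d) _ _ step).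
- move=> b x y; apply/ffunP => i; rewrite !ffunE.
  by case: unliftP => [j|] _ //=; rewrite ffunE.
- move=> x y /=; rewrite -[in RHS]sum1_card [in RHS]big_mkcond big_ord_recl -big_mkcond /=.
  rewrite !inE !ffunE unlift_none.
  under [in RHS]eq_bigl do rewrite inE !ffunE liftK.
  rewrite sum1_card exprD; case: eqP => _ /=; first by rewrite expr0.
  by rewrite expr1.
Qed.

(** * Binomial lower bounds *)

(** The Poisson weight m^j / j! is maximal at j = m, since the factors of j! beyond m are at least m
    and those up to m are at most m. *)
Lemma fact_expn_le (m j : nat) : (m`! * m ^ j <= j`! * m ^ m)%N.
Proof.
have up i : (m`! * m ^ i <= (m + i)`!)%N.
  elim: i => [|i IH]; first by rewrite expn0 muln1 addn0.
  rewrite addnS factS expnSr mulnA [leqRHS]mulnC.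
  by apply: leq_mul => //; rewrite leqW ?leq_addr.
have down i : (i <= m -> m`! <= (m - i)`! * m ^ i)%N.
  elim: i => [|i IH] im; first by rewrite expn0 muln1 subn0.
  apply: leq_trans (IH (ltnW im)) _.
  rewrite -(subnSK im) factS expnS mulnCA mulnA leq_mul // leq_mul //.
  by rewrite subnSK // leq_subr.
have [jm|mj] := leqP j m.
  have := leq_mul (down _ (leq_subr j m)) (leqnn (m ^ j)).
  by rewrite subKn // -mulnA -expnD subnK.
have := leq_mul (up (j - m)%N) (leqnn (m ^ m)).
by rewrite subnKC ?(ltnW mj) // -mulnA -expnD subnK // ltnW.
Qed.

(* For the binomial law with success probability m / k, the value m is a mode. *)
Lemma bin_mode (k m : nat) : (m <= k)%N ->
  (k ^ k <= k.+1 * ('C(k, m) * (m ^ m * (k - m) ^ (k - m))))%N.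
Proof.
(* The binomial expansion has [k.+1] terms, each at most the one of index [m]: a ratio of two terms
   is a product of two Poisson ratios. *)
move=> mk; have {1}-> : (k ^ k = (k - m + m) ^ k)%N by rewrite subnK.
rewrite Pascal -[X in (_ <= X * _)%N]card_ord -sum_nat_const.
apply: leq_sum => i _; have ik : (i <= k)%N by rewrite -ltnS.
have pos : (0 < i`! * (k - i)`! * (m`! * (k - m)`!))%N by rewrite !muln_gt0 !fact_gt0.
rewrite -(leq_pmul2r pos).
have bi := bin_fact ik; have bm := bin_fact mk.
have := leq_mul (fact_expn_le m i) (fact_expn_le (k - m) (k - i)).
move=> /(leq_mul (leqnn k`!)) => h.
have -> : ('C(k, i) * ((k - m) ^ (k - i) * m ^ i) *
  (i`! * (k - i)`! * (m`! * (k - m)`!)) =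
  k`! * (m`! * m ^ i * ((k - m)`! * (k - m) ^ (k - i))))%N.
  by rewrite -bi; ring.
have -> : ('C(k, m) * (m ^ m * (k - m) ^ (k - m)) *
  (i`! * (k - i)`! * (m`! * (k - m)`!)) =
  k`! * (i`! * m ^ m * ((k - i)`! * (k - m) ^ (k - m))))%N.
  by rewrite -bm; ring.
exact: h.
Qed.

(** Relative entropy is bounded by chi-square: with [2 * m / k = 1 + y], the inequality
    [1 + y <= expR y] and its analogue for [- y] bound the entropy factor left by [bin_mode] by
    [expR (k * y ^+ 2)]. *)
Lemma bin_ge_gaussian (R : realType) (k m : nat) : (0 < k)%N -> (m <= k)%N ->
  expR (- ((2 * m%:R - k%:R) ^+ 2 / k%:R)) / k.+1%:R <= 'C(k, m)%:R / 2 ^+ k :> R.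
Proof.
move=> k0 mk; have kR : 0 < k%:R :> R by rewrite ltr0n.
have k1R : 0 < k.+1%:R :> R by rewrite ltr0n.
pose g : R := (2 * m%:R - k%:R) ^+ 2 / k%:R.
set y : R := 2 * m%:R / k%:R - 1.
have e1 : (2 * m%:R / k%:R) ^+ m <= expR (m%:R * y).
  rewrite expRM_natl lerXn2r ?nnegrE ?expR_ge0 ?divr_ge0 ?mulr_ge0 ?ler0n //.
  by have := expR_ge1Dx y; rewrite /y; lra.
have e2 : (2 * (k - m)%:R / k%:R) ^+ (k - m) <= expR ((k - m)%:R * - y).
  rewrite expRM_natl lerXn2r ?nnegrE ?expR_ge0 ?divr_ge0 ?mulr_ge0 ?ler0n //.
  have -> : 2 * (k - m)%:R / k%:R = 1 + - y.
    by rewrite /y natrB //; field; rewrite gt_eqF.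
  exact: expR_ge1Dx.
have := ler_pM (exprn_ge0 _ _) (exprn_ge0 _ _) e1 e2.
move=> /(_ ltac:(by rewrite divr_ge0 ?mulr_ge0) ltac:(by rewrite divr_ge0 ?mulr_ge0)).
rewrite -expRD.
have -> : m%:R * y + (k - m)%:R * - y = g.
  by rewrite /g /y natrB //; field; rewrite gt_eqF.
set P : R := m%:R ^+ m * (k - m)%:R ^+ (k - m).
have -> : (2 * m%:R / k%:R) ^+ m * (2 * (k - m)%:R / k%:R) ^+ (k - m) =
  2 ^+ k * P / k%:R ^+ k.
  have split_exp (x : R) : x ^+ k = x ^+ m * x ^+ (k - m) by rewrite -exprD subnKC.
  rewrite !expr_div_n !exprMn (split_exp 2) (split_exp k%:R) invfM /P.
  move: (2 ^+ m) (2 ^+ (k - m)) (m%:R ^+ m) ((k - m)%:R ^+ (k - m)) (k%:R ^+ m)^-1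
    (k%:R ^+ (k - m))^-1 => a b c e f h.
  by ring.
have P0 : 0 < P.
  rewrite /P mulr_gt0 //.
    by case: (m) => [|n]; rewrite ?expr0 // exprn_gt0 // ltr0n.
  by case: (k - m)%N => [|n]; rewrite ?expr0 // exprn_gt0 // ltr0n.
have kk : 0 < k%:R ^+ k :> R by rewrite exprn_gt0.
rewrite ler_pdivrMr // => h.
have mode : k%:R ^+ k <= k.+1%:R * ('C(k, m)%:R * P) :> R.
  by rewrite /P -!natrX -!natrM ler_nat bin_mode.
rewrite expRN -/g ler_pdivrMr // [leRHS]mulrAC ler_pdivlMr ?exprn_gt0 //.
rewrite mulrC ler_pdivrMr ?expR_gt0 // -(ler_pM2r P0).
have e0 := expR_gt0 g.
apply: (le_trans h); rewrite -subr_ge0.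
have -> : 'C(k, m)%:R * k.+1%:R * expR g * P - expR g * k%:R ^+ k =
  (k.+1%:R * ('C(k, m)%:R * P) - k%:R ^+ k) * expR g by ring.
by rewrite mulr_ge0 ?subr_ge0 // ltW.
Qed.

(** An [m]-subset of [D] and an arbitrary subset of its complement determine, injectively, the
    indicator of their union. *)
Lemma card_bits_ge (T : finType) (D : {set T}) (m : nat) :
  ('C(#|D|, m) * 2 ^ (#|T| - #|D|)
    <= #|[pred A : {ffun T -> bool} | #|[pred i in D | A i]| == m]|)%N.
Proof.
have -> : (#|T| - #|D|)%N = #|~: D| by rewrite [RHS]cardsCs finset.setCK.
rewrite -cards_draws -card_powerset -cardsX.
pose h (BC : {set T} * {set T}) : {ffun T -> bool} :=
  [ffun i => (i \in BC.1) || (i \in BC.2)].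
rewrite -(card_in_imset (f := h)).
  apply: subset_leq_card; apply/fintype.subsetP => A /imsetP[[B C]].
  rewrite !inE /= => /andP[/andP[BD /eqP <-] CD] ->; apply/eqP/eq_card => i.
  rewrite !inE ffunE /=; have [iB|iB] := boolP (i \in B).
    by rewrite (fintype.subsetP BD).
  case: (boolP (i \in C)) => [/(fintype.subsetP CD)|]; last by rewrite andbF.
  by rewrite inE => /negPf ->.
move=> [B C] [B' C']; rewrite !inE /= => /andP[/andP[BD _] CD] /andP[/andP[BD' _] CD'] E.
have Ei i : (i \in B) || (i \in C) = (i \in B') || (i \in C').
  by move/ffunP/(_ i): E; rewrite !ffunE.
have inD i : i \in D -> (i \in C) = false /\ (i \in C') = false.
  move=> iD; split; apply/negP; [move/(fintype.subsetP CD) | move/(fintype.subsetP CD')];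
    by rewrite inE iD.
have notD i : i \notin D -> (i \in B) = false /\ (i \in B') = false.
  move=> iD; split; apply/negP; [move/(fintype.subsetP BD) | move/(fintype.subsetP BD')];
    by rewrite (negPf iD).
congr pair; apply/finset.setP => i; have := Ei i.
  have [/inD[-> ->]|/notD[-> ->]//] := boolP (i \in D); by rewrite !orbF.
by have [/inD[-> ->]|/notD[-> ->]] := boolP (i \in D).
Qed.

(** Since [k - floor(rho * k) = ceil((1 - rho) * k)], a single size [m] serves both halves of
    [hatmid]. The additive 2 pays for rounding [rho * k] down. *)
Lemma floor_mul_nat (R : realType) (eps rho : R) (k : nat) :
  0 < rho < 1 -> `|1 / 2 - rho| < eps ->
  exists m : nat, [/\ m%:Z = Num.floor (rho * k%:R),
    (k - m)%:Z = Num.ceil ((1 - rho) * k%:R), (m <= k)%N &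
    (2 * m%:R - k%:R) ^+ 2 <= (2 * eps * k%:R + 2) ^+ 2].
Proof.
move=> /andP[r0 r1] reps; have k0 : 0 <= k%:R :> R by rewrite ler0n.
have x0 : 0 <= rho * k%:R by rewrite mulr_ge0 // ltW.
exists `|Num.floor (rho * k%:R)|%N.
have mE : `|Num.floor (rho * k%:R)|%N%:Z = Num.floor (rho * k%:R).
  by rewrite gez0_abs // floor_ge0.
set m := `|_|%N in mE *.
have m_le : m%:R <= rho * k%:R.
  by have := floor_le (rho * k%:R); rewrite -mE.
have m_gt : rho * k%:R < m%:R + 1.
  by have := floorD1_gt (rho * k%:R); rewrite -mE intrD.
have mk : (m <= k)%N.
  by rewrite -(ler_nat R); apply: le_trans m_le _; rewrite ler_piMl // ltW.
split=> //.
  apply/esym/ceil_def; rewrite -subzn // !rmorphB /= -!pmulrn.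
  by apply/andP; split; lra.
move: reps; rewrite ltr_norml => /andP[h1 h2].
have e0 : 0 < eps by lra.
have a1 : (rho - 1 / 2) * k%:R <= eps * k%:R by rewrite ler_wpM2r //; lra.
have a2 : (1 / 2 - rho) * k%:R <= eps * k%:R by rewrite ler_wpM2r //; lra.
have b0 : 0 <= eps * k%:R by rewrite mulr_ge0 // ltW.
rewrite -subr_ge0 subr_sqr mulr_ge0 //; lra.
Qed.

(** * Midpoints in Hamming graphs *)

Section HammingMidpoints.
Variables (R : realType) (d : nat) (r : 'I_d -> nat).
Implicit Types s t : hvertex r.

Definition hmix (A : {ffun 'I_d -> bool}) s t : hvertex r :=
  [ffun i => if A i then t i else s i].

Definition diff_set s t : {set 'I_d} := [set i | s i != t i].

Lemma hamming_hmixl (A : {ffun 'I_d -> bool}) s t :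
  hamming s (hmix A s t) = #|[pred i in diff_set s t | A i]|.
Proof.
apply: eq_card => i; rewrite !inE ffunE.
by case: (A i); rewrite ?andbT ?andbF // eqxx.
Qed.

Lemma hamming_hmixr (A : {ffun 'I_d -> bool}) s t :
  hamming (hmix A s t) t = #|[pred i in diff_set s t | ~~ A i]|.
Proof.
apply: eq_card => i; rewrite !inE ffunE.
by case: (A i); rewrite ?andbT ?andbF // eqxx.
Qed.

Lemma hmix_split (A : {ffun 'I_d -> bool}) s t : (#|[pred i in diff_set s t | A i]| +
  #|[pred i in diff_set s t | ~~ A i]|)%N = hamming s t.
Proof.
rewrite /hamming -(cardID A [set i | s i != t i]).
by congr (_ + _)%N; apply: eq_card => i; rewrite !inE andbC.
Qed.

Lemma diff_setC s t : diff_set s t = diff_set t s.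
Proof. by apply/finset.setP => i; rewrite !inE eq_sym. Qed.

Lemma hammingC s t : hamming s t = hamming t s.
Proof. by rewrite /hamming -/(diff_set s t) diff_setC. Qed.

(** The first point is at distance [m] from [s] and falls in the floor half; the opposite exchange
    is at distance [hamming s t - m] and falls in the ceiling half. *)
Lemma hmix_hatmid (rho : R) (A : {ffun 'I_d -> bool}) s t (m : nat) :
  m%:Z = Num.floor (rho * (hamming s t)%:R) ->
  (hamming s t - m)%:Z = Num.ceil ((1 - rho) * (hamming s t)%:R) ->
  #|[pred i in diff_set s t | A i]| = m ->
  hmix A s t \in hatmid (hamming_graph (r := r)) rho s t /\
  hmix A t s \in hatmid (hamming_graph (r := r)) rho s t.
Proof.
move=> mfl mce Am; have sp := hmix_split A s t.
rewrite !inE !gdist_hamming -mfl -mce; split; apply/orP; [left|right].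
  by rewrite hamming_hmixl hamming_hmixr Am -Am sp !eqxx.
rewrite [hamming s (hmix A t s)]hammingC hamming_hmixr.
rewrite [hamming (hmix A t s) t]hammingC hamming_hmixl (diff_setC t s) addnC sp.
by rewrite -sp Am addKn !eqxx.
Qed.

(* All coordinates get the common alphabet [{i & 'I_(r i)}], to which
   [ffun_interpolation] applies. *)
Definition hembed s : {ffun 'I_d -> {i : 'I_d & 'I_(r i)}} :=
  [ffun i => Tagged (fun i => 'I_(r i)) (s i)].

Lemma hembed_inj : injective hembed.
Proof.
move=> s t /ffunP E; apply/ffunP => i; have := E i; rewrite !ffunE => /eqP.
by rewrite eq_Tagged => /eqP.
Qed.

Lemma hembed_mix (A : {ffun 'I_d -> bool}) s t :
  fmix A (hembed s) (hembed t) = hembed (hmix A s t).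
Proof. by apply/ffunP => i; rewrite !ffunE; case: (A i). Qed.

Lemma hembed_eq s t i : (hembed s i == hembed t i) = (s i == t i).
Proof. by rewrite !ffunE eq_Tagged. Qed.

End HammingMidpoints.

Lemma sumr_indicator (R : realType) (X : finType) (P : pred X) :
  \sum_x (P x)%:R = #|P|%:R :> R.
Proof.
rewrite -sum1_card natr_sum [RHS]big_mkcond.
by apply: eq_bigr => x _; rewrite unfold_in; case: (P x).
Qed.

(** The interpolation inequality is applied to the indicators of [S], [T] and, for both [phi] and
    [psi], the midpoint set. The weight [w] indicates that [A] has the prescribed number of points
    in the difference set. On the support of [pi] the distance is at least [D], and the mean of [w]
    over [A] is at least [b]. *)
Lemma hatmid_set_card_ge (R : realType) (N : nat) (mu b rho : R) (d D : nat)
    (r : 'I_d -> nat) (S T : {set hvertex r}) :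
  (6 <= N)%N -> 0 <= mu <= 1 -> S != finset.set0 -> T != finset.set0 -> 0 <= b ->
  (forall s t, s \in S -> t \in T -> (D <= hamming s t)%N) ->
  (forall k, (D <= k <= d)%N -> exists m : nat,
     [/\ m%:Z = Num.floor (rho * k%:R),
         (k - m)%:Z = Num.ceil ((1 - rho) * k%:R) &
         b <= 'C(k, m)%:R / 2 ^+ k]) ->
  (expR (2 * mu / N.+2%:R) ^+ D * b) ^+ N.+2 * (#|S|%:R * #|T|%:R) <=
  (1 + (mu + 5 / (2 * N%:R)) ^+ 2 / N%:R) ^+ N ^+ d
  * #|hatmid_set (hamming_graph (r := r)) rho S T|%:R ^+ 2.
Proof.
move=> N6 mu01 S0 T0 b0 hD hb.
set M := hatmid_set _ _ _ _; set gam := expR _.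
have gam1 : 1 <= gam.
  by rewrite -expR0 ler_expR divr_ge0 ?mulr_ge0 //; case/andP: mu01.
have gam0 : 0 <= gam by exact: expR_ge0.
pose ES := [set hembed s | s in S]; pose ET := [set hembed t | t in T].
pose EM := [set hembed u | u in M].
have cES : #|ES| = #|S| by rewrite card_imset //; exact: hembed_inj.
have cET : #|ET| = #|T| by rewrite card_imset //; exact: hembed_inj.
have cEM : #|EM| = #|M| by rewrite card_imset //; exact: hembed_inj.
have [pi [pi0 pi1 pis piP]] := @ffun_interpolation R {i : 'I_d & 'I_(r i)} N mu d N6 mu01
  (fun x => (x \in ES)%:R) (fun x => (x \in ET)%:R)
  (fun x => ler0n _ _) (fun x => ler0n _ _).
rewrite !sumr_indicator cES cET in pi1 piP.
have {}pi1 : \sum_x \sum_y pi x y = 1 by apply: pi1; rewrite ltr0n card_gt0.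
have /boolp.choice[m mP] (k : nat) : exists m : nat, (D <= k <= d)%N ->
     [/\ m%:Z = Num.floor (rho * k%:R),
         (k - m)%:Z = Num.ceil ((1 - rho) * k%:R) &
         b <= 'C(k, m)%:R / 2 ^+ k].
  by have [/hb[m ?]|_] := boolP (D <= k <= d)%N; [exists m | exists 0%N].
pose w (x y : {ffun 'I_d -> {i : 'I_d & 'I_(r i)}}) (A : {ffun 'I_d -> bool}) : R :=
  (#|[pred i in [set i | x i != y i] | A i]| == m #|[set i | x i != y i]|)%:R.
have range s t : s \in S -> t \in T -> (D <= hamming s t <= d)%N.
  by move=> sS tT; rewrite hD // -[leqRHS]card_ord max_card.
have diffE (s t : hvertex r) : [set i | hembed s i != hembed t i] = diff_set s t.
  by apply/finset.setP => i; rewrite !inE hembed_eq.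
have H x y A : w x y A ^+ N.+2 * ((x \in ES)%:R * (y \in ET)%:R) <=
    (fmix A x y \in EM)%:R * (fmix A y x \in EM)%:R.
  have [/imsetP[s sS ->]|_] := boolP (x \in ES); last by rewrite mul0r mulr0 mulr_ge0.
  have [/imsetP[t tT ->]|_] := boolP (y \in ET); last by rewrite mul1r mulr0 mulr_ge0.
  rewrite /w diffE; case: eqP => [mA|_]; last by rewrite expr0n mul0r mulr_ge0.
    have [mf mc _] := mP _ (range _ _ sS tT).
    have [u1 u2] := hmix_hatmid mf mc mA.
    have inM u : u \in hatmid (hamming_graph (r := r)) rho s t -> hembed u \in EM.
      by move=> h; apply: imset_f; apply/finset.bigcupP; exists s => //;
        apply/finset.bigcupP; exists t.
    by rewrite !hembed_mix !inM // !mulr1 expr1n.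
have := piP w (fun x => (x \in EM)%:R) (fun x => (x \in EM)%:R).
move=> /(_ (fun _ _ _ => ler0n _ _) (fun _ => ler0n _ _) (fun _ => ler0n _ _) H).
rewrite !sumr_indicator cEM -expr2; apply: le_trans.
apply: ler_wpM2r; first by rewrite mulr_ge0.
have gDb : 0 <= gam ^+ D * b by rewrite mulr_ge0 ?exprn_ge0.
apply: lerXn2r; rewrite ?nnegrE //.
  apply: sumr_ge0 => x _; apply: sumr_ge0 => y _.
  by rewrite !mulr_ge0 ?exprn_ge0 ?invr_ge0 ?sumr_ge0.
rewrite -[leLHS]mul1r -[X in X * _ <= _]pi1 mulr_suml; apply: ler_sum => x _.
rewrite mulr_suml; apply: ler_sum => y _.
have [->|h] := eqVneq (pi x y) 0; first by rewrite !mul0r.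
apply: ler_wpM2l => //; have [] := pis _ _ h.
rewrite !ltr0n !lt0b => /imsetP[s sS xE] /imsetP[t tT yE].
have rg := range _ _ sS tT; have /andP[Dk kd] := rg.
have dE : [set i | x i != y i] = diff_set s t by rewrite xE yE diffE.
have [_ _ bm] := mP _ rg.
apply: ler_pM => //; first by rewrite exprn_ge0.
  by rewrite -cardsE dE; exact: (ler_weXn2l gam1 Dk).
apply: (le_trans bm).
rewrite card_ffun card_bool card_ord /w dE sumr_indicator natrX [leRHS]mulrC.
rewrite ler_pdivrMr ?exprn_gt0 // [leRHS]mulrAC ler_pdivlMr ?exprn_gt0 //.
have := card_bits_ge (diff_set s t) (m #|diff_set s t|); rewrite card_ord.
rewrite -(ler_nat R) natrM natrX => card_ge.
rewrite -[in 2 ^+ d](subnK kd) exprD mulrA.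
by apply: ler_wpM2r; rewrite ?exprn_ge0.
Qed.

(** * Choice of parameters for large dimension *)

Lemma eventually_succ_le_expR (R : realType) (c : R) : 0 < c ->
  (\forall d \near \oo, d.+1%:R <= expR (c * d%:R))%classic.
Proof.
move=> c0; near=> d.
have dR : 2 / c ^+ 2 <= d%:R by near: d; exact: nbhs_infty_ger.
have cd0 : 0 <= c * d%:R by rewrite mulr_ge0 // ltW.
apply: le_trans (expR_ge1Dxn 1 cd0).
rewrite -natr1 addrC lerD2l ler_pdivlMr // exprMn mulrC.
rewrite [d%:R ^+ 2]expr2 mulrA; apply: ler_wpM2r => //.
by move: dR; rewrite ler_pdivrMr ?exprn_gt0 // mulrC.
Unshelve. all: by end_near. Qed.

(** The gain [expR (2 * mu * D)] against [kappa ^+ d <= expR (delta ^+ 2 * d)] leaves about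
    [delta ^+ 2 * d] in the exponent. Replacing [delta] by [mu] costs [5 * delta / N] per coordinate
    and the size condition on [A] about [4 * N * epsilon ^+ 2]; taking [N] near [delta / epsilon]
    makes both of order [epsilon]. *)
Lemma hatmid_set_card_sqr_gt (R : realType) (delta epsilon : R) (N : nat) :
  0 < delta <= 1 -> 0 < epsilon -> 16 * ln 2 * epsilon < delta ^+ 2 ->
  delta / epsilon <= N%:R <= delta / epsilon + 1 ->
  forall (d D : nat) (r : 'I_d -> nat) (S T : {set hvertex r}) (rho : R),
  S != finset.set0 -> T != finset.set0 -> (0 < d)%N ->
  (forall s t, s \in S -> t \in T -> (D <= hamming s t)%N) ->
  delta * d%:R <= D%:R -> 0 < rho < 1 -> `|1 / 2 - rho| < epsilon ->
  N.+2%:R * (8 * epsilon + 4) <= epsilon / 10 * d%:R ->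
  d.+1%:R <= expR (epsilon / (10 * N.+2%:R) * d%:R) ->
  #|S|%:R * #|T|%:R * expR ((delta ^+ 2 - 16 * ln 2 * epsilon) * d%:R) <
  #|hatmid_set (hamming_graph (r := r)) rho S T|%:R ^+ 2.
Proof.
move=> /andP[del0 del1] eps0 eC /andP[N_ge N_le] d D r S T rho S0 T0 d0 hD dD.
move=> rho01 rhoe d1 d2.
have l2 := ln2_ge R.
have dR : 0 < d%:R :> R by rewrite ltr0n.
have e_small : 52 / 5 * epsilon < delta ^+ 2.
  by apply: le_lt_trans eC; rewrite ler_pM2r //; lra.
have del2 : delta ^+ 2 <= delta by rewrite expr2 ler_piMr // ltW.
have Nd : delta <= N%:R * epsilon by rewrite -ler_pdivrMr.
have Nd' : (N%:R - 1) * epsilon <= delta by rewrite -ler_pdivlMr // lerBlDr.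
(* This gives both [6 <= N] and [0 <= mu]. *)
have N10 : 52 / 5 <= N%:R * delta.
  rewrite -(ler_pM2r eps0); apply: (le_trans (ltW e_small)).
  by rewrite expr2 mulrAC ler_pM2r.
have NR : 0 < N%:R :> R by rewrite -(pmulr_lgt0 _ del0) (lt_le_trans _ N10).
have N6 : (6 <= N)%N.
  rewrite -(ler_nat R); apply: (@le_trans _ _ (N%:R * delta)); first by lra.
  by rewrite ler_piMr // ltW.
(* The shift cancels the one in [kappa], which becomes [(1 + delta ^+ 2 / N) ^+ N]. *)
pose mu := delta - 5 / (2 * N%:R).
have mu01 : 0 <= mu <= 1.
  have h : 5 / (2 * N%:R) <= delta by rewrite ler_pdivrMr ?mulr_gt0 //; lra.
  have h' : 0 <= 5 / (2 * N%:R) :> R by rewrite divr_ge0 // mulr_ge0.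
  by rewrite /mu; lra.
(* A bound for [(2 * epsilon * k + 2) ^+ 2 / k] over all [1 <= k <= d]. *)
pose q := 4 * epsilon ^+ 2 * d%:R + 8 * epsilon + 4.
pose b := expR (- q) / d.+1%:R.
have b0 : 0 < b by rewrite divr_gt0 ?expR_gt0.
have D0 : (0 < D)%N by rewrite -(ltr0n R) (lt_le_trans _ dD) // mulr_gt0.
have hb k : (D <= k <= d)%N -> exists m : nat,
    [/\ m%:Z = Num.floor (rho * k%:R), (k - m)%:Z = Num.ceil ((1 - rho) * k%:R) &
        b <= 'C(k, m)%:R / 2 ^+ k].
  move=> /andP[Dk kd]; have k0 := leq_trans D0 Dk.
  have [m [mf mc mk mq]] := floor_mul_nat k rho01 rhoe.
  exists m; split=> //; apply: le_trans (bin_ge_gaussian R k0 mk).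
  have kR : 0 < k%:R :> R by rewrite ltr0n.
  have kdR : k%:R <= d%:R :> R by rewrite ler_nat.
  apply: ler_pM; [exact: expR_ge0 | by rewrite invr_ge0 | | ]; last first.
    by rewrite lef_pV2 ?posrE ?ltr0n // ler_nat ltnS.
  rewrite ler_expR lerN2 ler_pdivrMr //; apply: (le_trans mq).
  have k1 : 1 <= k%:R :> R by rewrite ler1n.
  have -> : (2 * epsilon * k%:R + 2) ^+ 2 =
    (4 * epsilon ^+ 2 * k%:R + 8 * epsilon) * k%:R + 4 by ring.
  rewrite /q [X in _ <= X]mulrDl; apply: lerD; last by rewrite ler_peMr.
  apply: ler_wpM2r; first exact: ltW.
  rewrite lerD2r ler_wpM2l // mulr_ge0 // sqr_ge0 //.
have := hatmid_set_card_ge N6 mu01 S0 T0 (ltW b0) hD hb.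
set M := #|hatmid_set _ _ _ _|%:R.
have -> : mu + 5 / (2 * N%:R) = delta by rewrite /mu subrK.
set ST := #|S|%:R * #|T|%:R.
have ST0 : 0 < ST by rewrite mulr_gt0 // ltr0n card_gt0.
have kap : (1 + delta ^+ 2 / N%:R) ^+ N ^+ d <= expR (delta ^+ 2 * d%:R).
  have base0 : 0 <= 1 + delta ^+ 2 / N%:R.
    by rewrite addr_ge0 // divr_ge0 ?sqr_ge0 // ltW.
  rewrite expRM_natr; apply: lerXn2r; rewrite ?nnegrE ?expR_ge0 ?exprn_ge0 //.
  rewrite -[X in expR X](divfK (lt0r_neq0 NR)) expRM_natr.
  apply: lerXn2r; rewrite ?nnegrE ?expR_ge0 //.
  exact: expR_ge1Dx.
move=> /le_trans /(_ (ler_wpM2r (sqr_ge0 M) kap)) main.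
have lower : expR (2 * mu * D%:R) * expR (- (N.+2%:R * q + epsilon / 10 * d%:R)) <=
    (expR (2 * mu / N.+2%:R) ^+ D * b) ^+ N.+2.
  rewrite exprMn; apply: ler_pM; rewrite ?expR_ge0 //.
    rewrite -exprM -expRM_natr natrM.
    rewrite (_ : 2 * mu / N.+2%:R * (D%:R * N.+2%:R) = 2 * mu * D%:R) //.
    by move: (N.+2%:R) (ltr0Sn R N.+1) => n n0; field; rewrite gt_eqF.
  rewrite /b expr_div_n opprD expRD -expRM_natl mulrN.
  apply: ler_wpM2l; first exact: expR_ge0.
  rewrite expRN lef_pV2 ?posrE ?expR_gt0 ?exprn_gt0 ?ltr0n //.
  apply: (le_trans (lerXn2r N.+2 _ _ d2)); rewrite ?nnegrE ?expR_ge0 //.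
  rewrite -expRM_natl (_ : N.+2%:R * _ = epsilon / 10 * d%:R) //.
  by move: (N.+2%:R) (ltr0Sn R N.+1) => n n0; field; rewrite gt_eqF.
have {main lower} := le_trans (ler_wpM2r (ltW ST0) lower) main.
rewrite -expRD -ler_pdivrMl ?expR_gt0 // -expRN.
rewrite mulrA -expRD mulrC; apply: lt_le_trans.
rewrite ltr_pM2l // ltr_expR.
have muD : mu * (delta * d%:R) <= mu * D%:R by rewrite ler_wpM2l //; case/andP: mu01.
have muE : mu * delta = delta ^+ 2 - 5 / 2 * (delta / N%:R).
  by rewrite /mu; field; rewrite gt_eqF.
have dN : delta / N%:R <= epsilon by rewrite ler_pdivrMr // mulrC.
have qE : N.+2%:R * q = (4 * N.+2%:R * epsilon ^+ 2) * d%:R + N.+2%:R * (8 * epsilon + 4).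
  by rewrite /q; ring.
have nE : 4 * N.+2%:R * epsilon ^+ 2 <= 4 * epsilon + 12 * epsilon ^+ 2.
  have : N.+2%:R * epsilon <= delta + 3 * epsilon by rewrite -natr1 -natr1; lra.
  by move=> /(ler_wpM2r (ltW eps0)); nra.
have e2 : epsilon ^+ 2 <= 5 / 52 * epsilon.
  by rewrite expr2 ler_pM2r //; lra.
(* In units of [epsilon] the terms are at most 5, 4 + 60/52, 1/10 and 1/10, in total less than 52/5.
   The two tenths pay for the constant terms of [q] and for the polynomial factor [d.+1]. *)
have tot : (2 * (5 / 2 * (delta / N%:R)) + 4 * N.+2%:R * epsilon ^+ 2
    + epsilon / 10 + epsilon / 10) * d%:R
   < (16 * ln 2 * epsilon) * d%:R.
  rewrite ltr_pM2r //.
  have : 52 / 5 * epsilon <= 16 * ln 2 * epsilon by rewrite ler_pM2r //; lra.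
  by lra.
have muD' : (delta ^+ 2 - 5 / 2 * (delta / N%:R)) * d%:R <= mu * D%:R.
  by rewrite -muE -mulrA.
rewrite qE; move: tot muD' d1; set x := delta / N%:R.
by lra.
Qed.

Local Open Scope classical_set_scope.

Theorem theorem3p5 (R : realType) (delta epsilon C : R)
    (hdelta : 0 < delta) (hepsilon : 0 < epsilon)
    (hC : C = delta ^+ 2 - 16 * ln 2 * epsilon) (hC0 : 0 < C) :
  exists2 eta : nat -> R,
    eta @ \oo --> (0 : R) &
    \forall d \near \oo,
      forall (r : 'I_d -> nat) (S T : {set hvertex r}) (rho : R),
        (forall i, (0 < r i)%N) ->
        S != finset.set0 -> T != finset.set0 ->
        delta * d%:R <= (gdist_set (hamming_graph (r := r)) S T)%:R ->
        0 < rho < 1 -> `|1 / 2 - rho| < epsilon ->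
        Num.sqrt (#|S|%:R * #|T|%:R) * expR (C * d%:R * (1 / 2 + eta d))
          < #|hatmid_set (hamming_graph (r := r)) rho S T|%:R.
Proof.
exists (fun _ => 0); first exact: cvg_cst.
have de0 : 0 <= delta / epsilon by rewrite divr_ge0 // ltW.
pose N := (Num.trunc (delta / epsilon)).+1.
have N_bounds : delta / epsilon <= N%:R <= delta / epsilon + 1.
  have /andP[h1 h2] := truncn_itv de0.
  by rewrite (ltW h2) /N -natr1 lerD2r.
have n0 : 0 < N.+2%:R :> R by rewrite ltr0n.
have c0 : 0 < epsilon / (10 * N.+2%:R) by rewrite divr_gt0 ?mulr_gt0.
near=> d.
have d_gt0 : (0 < d)%N by near: d; exact: nbhs_infty_gt.
have dR : 0 < d%:R :> R by rewrite ltr0n.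
have d1 : N.+2%:R * (8 * epsilon + 4) <= epsilon / 10 * d%:R.
  rewrite mulrC -ler_pdivrMl ?divr_gt0 //.
  by near: d; exact: nbhs_infty_ger.
have d2 : d.+1%:R <= expR (epsilon / (10 * N.+2%:R) * d%:R).
  by near: d; exact: eventually_succ_le_expR.
move=> r S T rho _ S0 T0; set D := gdist_set _ _ _ => dD rho01 rhoe.
have hD s t : s \in S -> t \in T -> (D <= hamming s t)%N.
  by move=> sS tT; rewrite -gdist_hamming gdist_set_le.
(* Distances are at most [d], so the nonempty sets [S] and [T] cannot be further apart; for
   [delta > 1] the claim is vacuous. *)
have del1 : delta <= 1.
  have /set0Pn[s sS] := S0; have /set0Pn[t tT] := T0.
  rewrite -(ler_pM2r dR) mul1r (le_trans dD) // ler_nat.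
  by apply: leq_trans (hD _ _ sS tT) _; rewrite -[leqRHS]card_ord max_card.
have eC : 16 * ln 2 * epsilon < delta ^+ 2 by move: hC0; rewrite hC subr_gt0.
have := @hatmid_set_card_sqr_gt R delta epsilon N _ hepsilon eC N_bounds d D r S T rho
  S0 T0 d_gt0 hD dD rho01 rhoe d1 d2.
rewrite hdelta del1 -hC => /(_ isT) main.
have ST0 : 0 <= #|S|%:R * #|T|%:R :> R by rewrite mulr_ge0.
suff : (Num.sqrt (#|S|%:R * #|T|%:R) * expR (C * d%:R * (1 / 2 + 0))) ^+ 2 <
    #|hatmid_set (hamming_graph (r := r)) rho S T|%:R ^+ 2.
  by rewrite ltr_pXn2r // nnegrE // mulr_ge0 ?sqrtr_ge0 ?expR_ge0.
rewrite exprMn sqr_sqrtr // -expRM_natl.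
by rewrite (_ : 2%:R * _ = C * d%:R) //; field.
Unshelve. all: by end_near. Qed.
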